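(* Let $(M^n,g)$ be a compact $n$-dimensional Riemannian manifold with $\mathrm{Ric}_g\ge0$, let $p>1$, and let $\Phi:[0,\infty)\to[0,\infty)$ satisfy the structure assumption (S) of the context. Put $h(x)=\Phi''(x)/\Phi'(x)$ and $\theta(x)=xh(x)$ for $x>0$, and suppose there are constants $b_1,b_2$ with $$-\frac12<b_1\le\theta(x)\le b_2<+\infty\quad\text{for all }x>0.$$ Let $u$ be a positive smooth solution on $M$ of the time-independent equation $$\operatorname{div}\left(\Phi'(|\nabla u|^2)\nabla u\right)-\frac p2\,\Phi(|\nabla u|^2)=0.$$ If there exist two positive constants $c$ and $C$ such that $c<u<C$, then $u$ must be constant.
   Context: Manifolds are connected; compact manifolds are without boundary. $\Phi\in C^3((0,\infty))$ is continuous and non-negative on $[0,\infty)$, with $\Phi'>0$ on $(0,\infty)$; $\Phi'(|\nabla u|^2)\nabla u$ is read as $0$ where $\nabla u=0$, and where $\Phi'(|\nabla u|^2)\nabla u$ is not differentiable the equation is understood in the weak (distributional) sense. Structure assumption (S): there exist $s>1$, $a\ge 0$ and constants $c_1,c_2>0$ such that for all $\sigma,\xi\in\mathbb{R}^n\setminus\{0\}$, $$c_1(a+|\sigma|)^{s-2}\le\Phi'(|\sigma|^2)\le c_2(a+|\sigma|)^{s-2},$$ $$c_1(a+|\sigma|)^{s-2}|\xi|^2\le\sum_{i,j=1}^n a_{ij}(\sigma)\xi_i\xi_j\le c_2(a+|\sigma|)^{s-2}|\xi|^2,$$ where $a_{ij}(\sigma)=2\Phi''(|\sigma|^2)\sigma_i\sigma_j+\Phi'(|\sigma|^2)\delta_{ij}$.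 *)

(* Defs.v *)
From HB Require Import structures.
From mathcomp Require Import all_boot all_order all_algebra.
From mathcomp Require Import all_classical all_reals all_analysis.

Set Implicit Arguments.
Unset Strict Implicit.
Unset Printing Implicit Defensive.

Import Order.TTheory GRing.Theory Num.Theory.
Import numFieldNormedType.Exports.

Local Open Scope classical_set_scope.
Local Open Scope ring_scope.

Definition basis_vec (R : realType) (n : nat) (a : 'I_n) : 'rV[R]_n :=
  delta_mx 0 a.

Definition partial (R : realType) (n : nat) (a : 'I_n) (f : 'rV[R]_n -> R) :
  'rV[R]_n -> R := fun y => 'D_(basis_vec R a) f y.

(* Only meant for open U: all partial derivatives of order at most k exist
   and are continuous on U. *)
Fixpoint Ck (R : realType) (n k : nat) (U : set 'rV[R]_n)
    (f : 'rV[R]_n -> R) : Prop :=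
  (forall y, U y -> {for y, continuous f}) /\
  match k with
  | 0%N => True
  | k'.+1 => forall a : 'I_n,
      (forall y, U y -> derivable f y (basis_vec R a)) /\ Ck k' U (partial a f)
  end.

Definition smooth_on (R : realType) (n : nat) (U : set 'rV[R]_n)
  (f : 'rV[R]_n -> R) : Prop := forall k, Ck k U f.

(* The norm of 'rV[R]_n in the library is the sup norm. *)
Definition enorm (R : realType) (n : nat) (v : 'rV[R]_n) : R :=
  Num.sqrt (\sum_(i < n) v 0 i ^+ 2).

(* Iterated Lebesgue integral; it is only applied to continuous compactly
   supported integrands, for which it is the integral over R^n. *)
Fixpoint integral_rV (R : realType) (n : nat) : ('rV[R]_n -> R) -> R :=
  match n return ('rV[R]_n -> R) -> R with
  | 0%N => fun f => f 0
  | n'.+1 => fun f =>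
      Rintegral (@lebesgue_measure R) [set: R]
        (fun t => integral_rV (fun v : 'rV[R]_n' => f (row_mx (const_mx t : 'rV[R]_1) v)))
  end.

(* Connected smooth n-manifolds without boundary, given by an atlas:
   [coord i] is a homeomorphism from the open set [dom i] onto an open subset
   of R^n, with inverse [param i]. *)
Record smooth_manifold (R : realType) (n : nat) (M : topologicalType) := {
  chart : Type;
  dom : chart -> set M;
  coord : chart -> M -> 'rV[R]_n;
  param : chart -> 'rV[R]_n -> M;
  mfd_hausdorff : hausdorff_space M;
  mfd_second_countable : @second_countable M;
  mfd_connected : connected [set: M];
  dom_cover : forall x : M, exists i, dom i x;
  dom_open : forall i, open (dom i);
  img_open : forall i, open (coord i @` dom i);
  coordK : forall i x, dom i x -> param i (coord i x) = x;
  coord_continuous : forall i x, dom i x -> {for x, continuous (coord i)};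
  param_continuous :
    forall i y, (coord i @` dom i) y -> {for y, continuous (param i)};
  transition_smooth : forall i j (b : 'I_n),
    smooth_on (coord i @` (dom i `&` dom j))
      (fun y => coord j (param i y) 0 b)
}.

Definition img (R : realType) (n : nat) (M : topologicalType)
  (A : smooth_manifold R n M) (i : chart A) : set 'rV[R]_n :=
  coord i @` dom i.

Definition smooth_fun (R : realType) (n : nat) (M : topologicalType)
  (A : smooth_manifold R n M) (u : M -> R) : Prop :=
  forall i : chart A, smooth_on (img i) (u \o param i).

(* [gmx i y] is the Gram matrix of the coordinate frame of the chart i at the
   point of coordinates y.  [jacobian f y] has entries d(f^b)/d(y^a) in row a
   and column b. *)
Record riemannian_metric (R : realType) (n : nat) (M : topologicalType)
    (A : smooth_manifold R n M) := {
  gmx : chart A -> 'rV[R]_n -> 'M[R]_n;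
  gmx_smooth : forall (i : chart A) (a b : 'I_n),
    smooth_on (img i) (fun y => gmx i y a b);
  gmx_sym : forall (i : chart A) y, img i y -> (gmx i y)^T = gmx i y;
  gmx_posdef : forall (i : chart A) y (v : 'rV[R]_n), img i y -> v != 0 ->
    0 < (v *m gmx i y *m v^T) 0 0;
  gmx_change : forall (i j : chart A) x, dom i x -> dom j x ->
    gmx i (coord i x) =
      jacobian (coord j \o param i) (coord i x)
        *m gmx j (coord j x)
        *m (jacobian (coord j \o param i) (coord i x))^T
}.

Section LocalCoordinates.
Variables (R : realType) (n : nat) (G : 'rV[R]_n -> 'M[R]_n).

(* Gamma^c_{ab} *)
Definition christoffel (a b c : 'I_n) (y : 'rV[R]_n) : R :=
  2^-1 * \sum_(d < n) invmx (G y) c d *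
    (partial a (fun z => G z b d) y + partial b (fun z => G z a d) y
     - partial d (fun z => G z a b) y).

(* R_{ab} = d_c Gamma^c_{ab} - d_b Gamma^c_{ac}
            + Gamma^c_{cd} Gamma^d_{ab} - Gamma^c_{bd} Gamma^d_{ac} *)
Definition ricci (y : 'rV[R]_n) : 'M[R]_n :=
  \matrix_(a, b)
    (\sum_(c < n) (partial c (christoffel a b c) y
                   - partial b (christoffel a c c) y)
     + \sum_(c < n) \sum_(d < n)
         (christoffel c d c y * christoffel a b d y
          - christoffel b d c y * christoffel a c d y)).

Definition sqnorm (y v : 'rV[R]_n) : R := (v *m G y *m v^T) 0 0.

(* Components g^{ab} d_b f of the gradient. *)
Definition grad (f : 'rV[R]_n -> R) (y : 'rV[R]_n) : 'rV[R]_n :=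
  (\row_a partial a f y) *m invmx (G y).

Definition vol_density (y : 'rV[R]_n) : R := Num.sqrt (\det (G y)).

Definition divergence (V : 'rV[R]_n -> 'rV[R]_n) (y : 'rV[R]_n) : R :=
  (vol_density y)^-1 *
    \sum_(a < n) partial a (fun z => vol_density z * V z 0 a) y.

(* Phi'(|grad f|^2) grad f; where grad f = 0 it is 0, whatever value the
   library gives to Phi'(0). *)
Definition flux (Phi : R -> R) (f : 'rV[R]_n -> R) (y : 'rV[R]_n) : 'rV[R]_n :=
  derive1 Phi (sqnorm y (grad f y)) *: grad f y.

Definition classical_eq_at (Phi : R -> R) (p : R) (f : 'rV[R]_n -> R)
    (y : 'rV[R]_n) : Prop :=
  divergence (flux Phi f) y - p / 2 * Phi (sqnorm y (grad f y)) = 0.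

Definition test_function (U : set 'rV[R]_n) (phi : 'rV[R]_n -> R) : Prop :=
  [/\ smooth_on setT phi,
      compact (closure [set z | phi z != 0]) &
      closure [set z | phi z != 0] `<=` U].

(* The equation in the sense of distributions on the open set U; note that
   <flux, grad phi> = \sum_a flux^a d_a phi. *)
Definition weak_eq_on (Phi : R -> R) (p : R) (f : 'rV[R]_n -> R)
    (U : set 'rV[R]_n) : Prop :=
  forall phi, test_function U phi ->
    integral_rV (fun z =>
      - ((\sum_(a < n) flux Phi f z 0 a * partial a phi z)
         + p / 2 * Phi (sqnorm z (grad f z)) * phi z) * vol_density z) = 0.

End LocalCoordinates.

Definition ricci_nonneg (R : realType) (n : nat) (M : topologicalType)
  (A : smooth_manifold R n M) (g : riemannian_metric A) : Prop :=
  forall (i : chart A) (y v : 'rV[R]_n), img i y ->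
    0 <= (v *m ricci (gmx g i) y *m v^T) 0 0.

(* div (Phi'(|grad u|^2) grad u) - (p/2) Phi(|grad u|^2) = 0, pointwise where
   Phi'(|grad u|^2) grad u is differentiable, and in the sense of
   distributions near the points where it is not. *)
Definition solution (R : realType) (n : nat) (M : topologicalType)
  (A : smooth_manifold R n M) (g : riemannian_metric A)
  (Phi : R -> R) (p : R) (u : M -> R) : Prop :=
  forall (i : chart A) (y : 'rV[R]_n), img i y ->
    (differentiable (flux (gmx g i) Phi (u \o param i)) y ->
       classical_eq_at (gmx g i) Phi p (u \o param i) y) /\
    (~ differentiable (flux (gmx g i) Phi (u \o param i)) y ->
       exists U : set 'rV[R]_n, [/\ open U, U y, U `<=` img i &
         weak_eq_on (gmx g i) Phi p (u \o param i) U]).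

(* Functions on [0, +oo) are represented by functions on R whose values on
   negative numbers are irrelevant. *)
Definition admissible (R : realType) (Phi : R -> R) : Prop :=
  [/\ {within `[0, +oo[, continuous Phi},
      forall x, 0 <= x -> 0 <= Phi x,
      forall k, (k < 3)%N -> forall x, 0 < x -> derivable (derive1n k Phi) x 1,
      forall x, 0 < x -> {for x, continuous (derive1n 3 Phi)} &
      forall x, 0 < x -> 0 < derive1 Phi x].

Definition structure_coef (R : realType) (n : nat) (Phi : R -> R)
  (sigma : 'rV[R]_n) (i j : 'I_n) : R :=
  2 * derive1n 2 Phi (enorm sigma ^+ 2) * sigma 0 i * sigma 0 j
  + derive1 Phi (enorm sigma ^+ 2) * (i == j)%:R.

Definition structure_assumption (R : realType) (n : nat) (Phi : R -> R) : Prop :=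
  exists s a c1 c2 : R, [/\ 1 < s, 0 <= a, 0 < c1, 0 < c2 &
    forall sigma xi : 'rV[R]_n, sigma != 0 -> xi != 0 ->
      let w := (a + enorm sigma) `^ (s - 2) in
      let q := \sum_(i < n) \sum_(j < n)
                 structure_coef Phi sigma i j * xi 0 i * xi 0 j in
      [/\ c1 * w <= derive1 Phi (enorm sigma ^+ 2),
          derive1 Phi (enorm sigma ^+ 2) <= c2 * w,
          c1 * w * enorm xi ^+ 2 <= q &
          q <= c2 * w * enorm xi ^+ 2]].

Definition hfun (R : realType) (Phi : R -> R) (x : R) : R :=
  derive1n 2 Phi x / derive1 Phi x.

Definition theta (R : realType) (Phi : R -> R) (x : R) : R := x * hfun Phi x.

(* Main.v *)
(** Write the equation as [div (Phi'(|grad u|^2) grad u) = (p/2) Phi(|grad u|^2) >= 0].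
    Where [grad u <> 0] it holds classically; expanding the divergence and
    dividing by [Phi'] turns it into
    [A^{ab} d_a d_b u + (first order terms) >= 0] with
    [A = g^-1 + 2 theta (grad u)^T (grad u) / |grad u|^2], which is uniformly
    elliptic because [theta] is bounded and stays above a constant [> -1/2].
    Hopf's strong maximum principle then applies, although nothing is known
    where [grad u = 0]: the comparison with the barrier [exp (- al |y - q|^2)]
    only uses the inequality at a point where [grad u] is a nonzero multiple of
    the gradient of the barrier.  Hence the set where [u] attains its maximum is
    open and closed. *)

Require Import Defs.
From HB Require Import structures.
From mathcomp Require Import all_boot all_order all_algebra.
From mathcomp Require Import all_classical all_reals all_analysis.
From mathcomp Require Import ring lra.
Import Order.TTheory GRing.Theory Num.Theory.
Import numFieldNormedType.Exports.
Local Open Scope classical_set_scope.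
Local Open Scope ring_scope.

(** * Positive definite matrices *)

(** The first order terms are harmless by a homogeneity count. Differentiating [|grad u|^2] in
    coordinates leaves, besides the Hessian, a term that contributes a cubic expression in [du],
    multiplied by [Phi'' / Phi' = theta / |grad u|^2]. The denominator is quadratic in [du] and
    [theta] is bounded, so the quotient is at most a constant times [|du|], however small the
    gradient is. The constants depend on the metric in the chart and are obtained only near each
    point, which is enough because openness of the maximum set is a local matter. Balls are measured
    by the Euclidean square [sqn], since those of the sup norm are not smooth. The barrier is not
    normalised to vanish on a sphere: it takes values in []0, 1]], so its weight [e] can be read off
    from the gap of [u] below its maximum, before the exponent [al] is fixed. *)

Definition posdef {R : realFieldType} {n : nat} (A : 'M[R]_n) : Prop :=
  A^T = A /\ forall v : 'rV[R]_n, v != 0 -> 0 < (v *m A *m v^T) 0 0.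

Lemma mulmx_form {R : pzRingType} {n : nat} (A : 'M[R]_n) (v w : 'rV[R]_n) :
  (v *m A *m w^T) 0 0 = \sum_a \sum_b v 0 a * A a b * w 0 b.
Proof.
rewrite mxE exchange_big; apply: eq_bigr => b _.
by rewrite mxE mulr_suml; apply: eq_bigr => a _; rewrite !mxE.
Qed.

Lemma posdef_ge0 {R : realFieldType} {n : nat} {A : 'M[R]_n} (v : 'rV[R]_n) :
  posdef A -> 0 <= (v *m A *m v^T) 0 0.
Proof.
case=> _ pA; have [->|/pA/ltW//] := eqVneq v 0.
by rewrite !mul0mx mxE.
Qed.

Lemma mulmx_form_sym {R : comPzRingType} {n : nat} {A : 'M[R]_n} (v w : 'rV[R]_n) :
  A^T = A -> (v *m A *m w^T) 0 0 = (w *m A *m v^T) 0 0.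
Proof.
move=> sA; have -> : (v *m A *m w^T) = (w *m A *m v^T)^T.
  by rewrite !trmx_mul trmxK sA mulmxA.
by rewrite mxE.
Qed.

(** The form is non-negative at [v - (b / c) *: w], the part of [v] orthogonal to [w]; its value
    there is [a - b ^+ 2 / c]. *)
Lemma posdef_CauchySchwarz {R : realFieldType} {n : nat} {A : 'M[R]_n}
    (v w : 'rV[R]_n) : posdef A ->
  ((v *m A *m w^T) 0 0) ^+ 2 <=
  (v *m A *m v^T) 0 0 * (w *m A *m w^T) 0 0.
Proof.
move=> pA; have [sA pA'] := pA.
have [->|w0] := eqVneq w 0; first by rewrite trmx0 !mulmx0 !mxE expr0n mulr0.
have wp := pA' _ w0; set c := (w *m A *m w^T) 0 0 in wp *.
set b := (v *m A *m w^T) 0 0; set a := (v *m A *m v^T) 0 0.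
have := posdef_ge0 (v - (b / c) *: w) pA.
have -> : ((v - (b / c) *: w) *m A *m (v - (b / c) *: w)^T) 0 0
    = a - b ^+ 2 / c.
  have -> : (v - (b / c) *: w)^T = v^T - (b / c) *: w^T by rewrite !raddfB /= linearZ.
  rewrite !mulmxBl !mulmxBr -!scalemxAl -!scalemxAr.
  have EM (X Y Z T : 'M[R]_1) s : (X - s *: Y - (s *: Z - s *: (s *: T))) 0 0
     = X 0 0 - s * Y 0 0 - (s * Z 0 0 - s * (s * T 0 0)) by rewrite !mxE.
  rewrite EM -/a -/b -/c -(mulmx_form_sym v w sA) -/b.
  by field; rewrite gt_eqF.
by rewrite subr_ge0 ler_pdivrMr.
Qed.

(** Induction on the size: splitting off the first row and column leaves the Schur complement
    [B - a^-1 r^T r], which is again positive definite. *)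
Lemma posdef_cholesky {R : rcfType} {n : nat} {A : 'M[R]_n} :
  posdef A -> exists P : 'M[R]_n, A = P^T *m P.
Proof.
elim: n A => [A _|n IH A [sA pA]]; first by exists 0; apply/matrixP => -[].
change ('M[R]_(1 + n)) in A.
set r := ursubmx A; set B := drsubmx A.
have [a aE] : exists a, ulsubmx A = a%:M.
  by exists (ulsubmx A 0 0); rewrite -mx11_scalar.
have AE : A = block_mx a%:M r r^T B.
  rewrite -[LHS]submxK aE; congr block_mx.
  by rewrite /r -[in RHS]sA trmx_ursub trmxK.
have sB : B^T = B by rewrite /B -[in RHS]sA trmx_drsub.
have qE (x : 'M[R]_1) w : row_mx x w *m A *m (row_mx x w)^T =
    x *m a%:M *m x^T + w *m r^T *m x^T + (x *m r *m w^T + w *m B *m w^T).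
  by rewrite AE mul_row_block tr_row_mx mul_row_col !mulmxDl.
have a0 : 0 < a.
  have := pA (row_mx (1%:M : 'M[R]_1) (0 : 'rV[R]_n)).
  rewrite qE !mul0mx trmx0 !mulmx0 !addr0 trmx1 mulmx1 mul1mx mxE eqxx.
  apply; apply/eqP => /(congr1 (@lsubmx R 1 1 n)).
  rewrite row_mxKl linear0 => /matrixP/(_ 0 0).
  by rewrite !mxE => /eqP; rewrite oner_eq0.
have an0 : a != 0 by rewrite gt_eqF.
have [P BE] : exists P : 'M[R]_n, B - a^-1 *: (r^T *m r) = P^T *m P.
  apply: IH; split; first by rewrite linearB linearZ /= trmx_mul trmxK sB.
  move=> w w0.
  (* This first coordinate minimises the form for given [w]; the minimum is the Schur complement's
     form at [w]. *)
  have := pA (row_mx (- a^-1 *: (w *m r^T)) w).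
  rewrite qE; set x := - a^-1 *: _; move=> H.
  have {}H := H _; have := H _.
  have -> : x *m a%:M *m x^T + w *m r^T *m x^T = 0.
    rewrite mul_mx_scalar /x scalerA mulrN divff // scaleN1r mulNmx.
    by rewrite addNr.
  rewrite add0r => {}H.
  suff -> : w *m (B - a^-1 *: (r^T *m r)) *m w^T = x *m r *m w^T + w *m B *m w^T.
    apply: H; apply: contra w0 => /eqP/(congr1 (@rsubmx R 1 1 n)).
    by rewrite row_mxKr linear0 => ->.
  rewrite mulmxBr mulmxBl addrC /x scaleNr mulNmx mulNmx; congr (- _ + _).
  by rewrite -!scalemxAr -!scalemxAl !mulmxA.
exists (block_mx (Num.sqrt a)%:M ((Num.sqrt a)^-1 *: r) 0 P).
rewrite (@tr_block_mx R 1 n 1 n) (@mulmx_block R 1 n 1 n 1 n) AE !trmx0 !mulmx0 !mul0mx !addr0.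
have sq : Num.sqrt a * Num.sqrt a = a by rewrite -expr2 sqr_sqrtr // ltW.
have s0 : Num.sqrt a != 0 by rewrite gt_eqF ?sqrtr_gt0.
rewrite tr_scalar_mx -scalar_mxM sq.
have -> : ((Num.sqrt a)^-1 *: r)^T = (Num.sqrt a)^-1 *: r^T by rewrite linearZ.
rewrite mul_scalar_mx mul_mx_scalar -scalemxAl -scalemxAr !scalerA mulfV // !scale1r.
by rewrite -invfM sq -BE addrC subrK.
Qed.

(** Writing [A = P^T P] turns the contraction into the sum of the values of the form [H] on the rows
    of [P]. It gives the sign of the second order part of an elliptic operator at a maximum. *)
Lemma posdef_contract_le0 {R : rcfType} {n : nat} {A H : 'M[R]_n} :
  posdef A -> (forall v : 'rV[R]_n, (v *m H *m v^T) 0 0 <= 0) ->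
  \sum_a \sum_b A a b * H a b <= 0.
Proof.
move=> /posdef_cholesky[P ->] Hle0.
have -> : \sum_a \sum_b (P^T *m P) a b * H a b =
    \sum_k (row k P *m H *m (row k P)^T) 0 0.
  under [RHS]eq_bigr do rewrite mulmx_form.
  rewrite [RHS]exchange_big; apply: eq_bigr => a _.
  rewrite [RHS]exchange_big; apply: eq_bigr => b _.
  rewrite mxE mulr_suml; apply: eq_bigr => k _.
  by rewrite !mxE mulrAC.
by apply: sumr_le0 => k _; apply: Hle0.
Qed.

(** * Functions with continuous partial derivatives *)

Lemma is_derive_line {R : realType} {n : nat} (f : 'rV[R]_n -> R)
    (x v : 'rV[R]_n) (s df : R) :
  is_derive (x + s *: v) v f df -> is_derive s 1 (fun t => f (x + t *: v)) df.
Proof.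
have E : (fun h => h^-1 *: (((fun t => f (x + t *: v)) \o shift s) (h *: 1)
            - f (x + s *: v))) =
   (fun h => h^-1 *: ((f \o shift (x + s *: v)) (h *: v) - f (x + s *: v))).
  apply/funext => h /=; congr (_ *: (f _ - _)).
  by rewrite [h%:A]mulr1 scalerDl addrCA.
by case=> df1 df2; split; rewrite /derivable /derive E.
Qed.

Lemma MVT_around0 {R : realType} (f df : R -> R) (h : R) :
  (forall x : R, `|x| <= `|h| -> is_derive x 1 f (df x)) ->
  exists2 c, `|c| <= `|h| & f h - f 0 = df c * h.
Proof.
move=> fdf.
have cont (a b : R) : (forall x : R, x \in `[a, b]%R -> `|x| <= `|h|) ->
    {within `[a, b], continuous f}.
  by move=> ab; apply: derivable_within_continuous => x /ab /fdf[].
have [h0|/ltW h0] := leP 0 h.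
- have H (x : R) : x \in `[0, h]%R -> `|x| <= `|h|.
    by rewrite in_itv /= (ger0_norm h0) => /andP[x0 xh]; rewrite ger0_norm.
  have [|c /H ch ->] := @MVT_segment R f df 0 h h0 _ (cont _ _ H).
    by move=> x xI; apply/fdf/H/subset_itv_oo_cc.
  by exists c; rewrite ?subr0.
- have H (x : R) : x \in `[h, 0]%R -> `|x| <= `|h|.
    by rewrite in_itv /= (ler0_norm h0) => /andP[x0 xh]; rewrite ler0_norm // lerN2.
  have [|c /H ch E] := @MVT_segment R f df h 0 h0 _ (cont _ _ H).
    by move=> x xI; apply/fdf/H/subset_itv_oo_cc.
  by exists c => //; rewrite -opprB E sub0r mulrN opprK.
Qed.

(** The codomain is [R^o], the field as a module over itself, so that the form can serve as a
    differential. *)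
Definition linear_form {R : pzRingType} {n : nat} (c : 'I_n -> R) (h : 'rV[R]_n) : R^o :=
  \sum_a h 0 a * c a.

Lemma linear_form_is_linear {R : comPzRingType} {n : nat} (c : 'I_n -> R) :
  linear (linear_form c).
Proof.
move=> k u v; rewrite /linear_form scaler_sumr -big_split /=.
by apply: eq_bigr => a _; rewrite !mxE mulrDl -mulrA.
Qed.

HB.instance Definition _ (R : comPzRingType) (n : nat) (c : 'I_n -> R) :=
  GRing.isLinear.Build R 'rV[R]_n R^o *:%R (linear_form c) (linear_form_is_linear c).

Lemma continuous_linear_form {R : realType} {n : nat} (c : 'I_n -> R) :
  continuous (linear_form c).
Proof.
have -> : linear_form c = \sum_a (fun h : 'rV[R]_n => h 0 a * c a).
  by apply/funext => h; rewrite fct_sumE.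
move=> x; elim/big_ind : _ => [|f g cf cg|a _]; first exact: cst_continuous.
  exact: continuousD.
by apply: continuousM; [exact: coord_continuous|exact: cst_continuous].
Qed.

Lemma coord_le_norm {R : realType} {n : nat} (h : 'rV[R]_n) a : `|h 0 a| <= `|h|.
Proof.
rewrite [leRHS]/Num.Def.normr /= mx_normrE; apply/bigmax_geP; right.
by exists (0, a).
Qed.

Lemma norm_leP {R : realType} {n : nat} (h : 'rV[R]_n) (e : R) : 0 <= e ->
  (forall a, `|h 0 a| <= e) -> `|h| <= e.
Proof.
move=> e0 he; rewrite [leLHS]/Num.Def.normr /= mx_normrE; apply/bigmax_leP; split => //=.
by move=> [i a] _ /=; rewrite ord1.
Qed.

(** The path from [y] to [y + h] changes one coordinate at a time, and the mean value theorem is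
    applied to each of its [n] segments. No point of the path leaves the sup norm ball, since its
    displacement from [y] has entries bounded by those of [h]. *)
Lemma C1_increment {R : realType} {n : nat} (f : 'rV[R]_n -> R)
    (y h : 'rV[R]_n) (e : R) :
  (forall z, `|z| <= `|h| -> forall a, derivable f (y + z) (basis_vec R a)
     /\ `|partial a f (y + z) - partial a f y| <= e) ->
  `|f (y + h) - f y - linear_form (fun a => partial a f y) h| <= n%:R * e * `|h|.
Proof.
move=> Hf.
pose w (k : nat) : 'rV[R]_n := \row_i (if (i < k)%N then h 0 i else 0).
have w0 : w 0%N = 0 by apply/rowP => i; rewrite !mxE.
have wn : w n = h by apply/rowP => i; rewrite !mxE ltn_ord.
have wS (k : 'I_n) : w k.+1 = w k + h 0 k *: basis_vec R k.
  apply/rowP => i; rewrite !mxE eqxx /= ltnS leq_eqVlt.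
  have [->|ne] := eqVneq i k; first by rewrite ltnn mulr1 add0r eqxx.
  by rewrite mulr0 addr0 (inj_eq val_inj) (negbTE ne).
have wle (k : 'I_n) t : `|t| <= `|h 0 k| -> `|w k + t *: basis_vec R k| <= `|h|.
  move=> tk; apply: norm_leP => // i; rewrite !mxE eqxx /=.
  have [->|ne] := eqVneq i k.
    by rewrite ltnn mulr1 add0r (le_trans tk) // coord_le_norm.
  by rewrite mulr0 addr0; case: ifP => _; rewrite ?normr0 // coord_le_norm.
have -> : f (y + h) - f y = \sum_(k < n) (f (y + w k.+1) - f (y + w k)).
  rewrite -(big_mkord xpredT (fun k => f (y + w k.+1) - f (y + w k))).
  by rewrite telescope_sumr // wn w0 addr0.
rewrite /linear_form -sumrB (le_trans (ler_norm_sum _ _ _)) //.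
have -> : n%:R * e * `|h| = \sum_(k < n) (e * `|h|).
  by rewrite sumr_const card_ord mulr_natl mulrnAl.
apply: ler_sum => k _.
have [|c ck] := @MVT_around0 R (fun t => f (y + w k + t *: basis_vec R k))
  (fun t => partial k f (y + w k + t *: basis_vec R k)) (h 0 k).
  move=> t tk; apply: is_derive_line; rewrite -addrA.
  have [d _] := Hf _ (wle _ _ tk) k.
  exact/derivableP.
rewrite scale0r addr0 wS addrA => ->.
rewrite [X in _ - X]mulrC -mulrBl normrM ler_pM // ?coord_le_norm //.
by rewrite -addrA; apply Hf; apply: wle.
Qed.

Lemma C1_differentiable {R : realType} {n : nat} {U : set 'rV[R]_n}
    {f : 'rV[R]_n -> R} {y : 'rV[R]_n} :
  open U -> Ck 1 U f -> U y -> differentiable f y.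
Proof.
move=> oU [_ fC] Uy.
pose L : {linear 'rV[R]_n -> R^o} := linear_form (fun a => partial a f y).
have := @diff_unique R 'rV[R]_n R^o f L y (@continuous_linear_form R n _).
(* The goal left is the little-o premise of [diff_unique]; given it, [L] is the differential and
   differentiability follows. *)
move=> dE; suff h : ltac:(match type of dE with ?P -> _ => exact P end).
  by apply/diff_locallyP; rewrite (dE h); split => //; exact: continuous_linear_form.
apply/eqaddoP => e e0.
have n0 : 0 < (n%:R + 1 : R) by rewrite ltr_wpDl.
(* Dividing by [n + 1] covers the case [n = 0] as well. *)
pose d := e / (n%:R + 1).
have d0 : 0 < d by rewrite divr_gt0.
have near_a a : \forall z \near y, derivable f z (basis_vec R a)
     /\ `|partial a f z - partial a f y| <= d.
  have [da ca] := fC a.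
  have Un : \forall z \near y, U z by exact: open_nbhs_nbhs.
  have := (proj1 ca) _ Uy; move=> /cvgrPdist_le/(_ _ d0) cd.
  near=> z; split; first by apply: da; near: z.
  by rewrite distrC; near: z.
have : nbhs y [set z | forall a, derivable f z (basis_vec R a)
     /\ `|partial a f z - partial a f y| <= d].
  exact: (filter_forall _ near_a).
move/nbhs_ballP => [r /= r0 rH].
have lt_r : \forall h \near nbhs (0 : 'rV[R]_n), `|h| < r.
  by apply/nbhs_ballP; exists r => //= h; rewrite -ball_normE /= sub0r normrN.
apply: filterS lt_r => h hr.
have -> : (f \o shift y - (cst (f y) + L)) h = f (y + h) - f y - L h.
  by rewrite [RHS]addrAC -addrA -opprD [L h + _]addrC [y + h]addrC.
apply: (le_trans (@C1_increment R n f y h d _)).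
  move=> z zh a; apply: rH; rewrite -ball_normE /= opprD addNKr normrN.
  exact: le_lt_trans zh hr.
rewrite ler_wpM2r // /d mulrA ler_pdivrMr // mulrC ler_pM2l //.
by rewrite lerDl.
Unshelve. all: by end_near.
Qed.

(** * Second order conditions at a maximum, along lines *)

Lemma second_derivative_at_max {R : realType} (f df : R -> R) (d2f : R) :
  (\forall t \near (0 : R), is_derive (t : R) 1 f (df t)) ->
  is_derive (0 : R) 1 df d2f ->
  (\forall t \near (0 : R), f t <= f 0) -> df 0 = 0 /\ d2f <= 0.
Proof.
move=> f1 f2 fmax.
have [r r0 rH] : exists2 r : R, 0 < r & forall t : R, `|t| < r ->
    is_derive t 1 f (df t) /\ f t <= f 0.
  have /nbhs_ballP[r /= r0 rH] : nbhs (0 : R) [set t : R | is_derive t 1 f (df t) /\ f t <= f 0].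
    exact: filterI.
  by exists r => // t tr; apply: rH; rewrite -ball_normE /= sub0r normrN.
have df0 : df 0 = 0.
  have d0 : is_derive (0 : R) 1 f 0.
    apply: (@derive1_at_max R f (- r) r 0).
    - by rewrite ge0_cp // ltW.
    - move=> t; rewrite in_itv /= -ltr_norml => /rH[h _].
      exact: (@ex_derive _ _ _ _ _ _ _ h).
    - by rewrite in_itv /= oppr_lt0 r0.
    - by move=> t; rewrite in_itv /= -ltr_norml => /rH[].
  have [d0' _] : is_derive (0 : R) 1 f (df 0) /\ f 0 <= f 0.
    by apply: rH; rewrite normr0.
  by rewrite -(@derive_val _ _ _ _ _ _ _ d0') (@derive_val _ _ _ _ _ _ _ d0).
(* If the second derivative were positive, [df] would be positive just to the right of [0], and the
   mean value theorem would give [f h > f 0]. *)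
split=> //; rewrite leNgt; apply/negP => d2f0.
have [cv lm] := f2.
have : (h^-1 *: ((df \o shift 0) (h *: 1) - df 0)) @[h --> (0 : R)^'] --> d2f.
  by rewrite -lm; exact: cv.
move=> /cvgrPdist_lt /(_ d2f d2f0).
rewrite near_withinE => /nbhs_ballP[e /= e0 eH].
have dfp (t : R) : 0 < t -> t < e -> 0 < df t.
  move=> t0 te; have := eH t.
  rewrite -ball_normE /= sub0r normrN gtr0_norm // => /(_ te).
  rewrite gt_eqF // => /(_ isT); rewrite addr0 df0 subr0 [t%:A]mulr1.
  move=> /ltr_normlP[_]; rewrite ltrBlDr ltrDl.
  by rewrite pmulr_rgt0 // invr_gt0.
pose h := Num.min r e / 2.
have m0 : 0 < Num.min r e by rewrite lt_min r0.
have h0 : 0 < h by rewrite divr_gt0.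
have hm : h < Num.min r e by rewrite ltr_pdivrMr // mulr2n mulrDr mulr1 ltrDl.
have [hr he] : h < r /\ h < e by move: hm; rewrite lt_min => /andP.
have [||c] := @MVT R f df 0 h h0.
- move=> t; rewrite in_itv /= => /andP[t0 th].
  by apply rH; rewrite gtr0_norm // (lt_trans th).
- apply: derivable_within_continuous => t; rewrite in_itv /= => /andP[t0 th].
  have [h' _] : is_derive t 1 f (df t) /\ f t <= f 0.
    by apply: rH; rewrite ger0_norm // (le_lt_trans th).
  exact: (@ex_derive _ _ _ _ _ _ _ h').
- rewrite in_itv /= subr0 => /andP[c0 ch] E.
  have : f h <= f 0 by apply rH; rewrite gtr0_norm.
  rewrite -subr_le0 E leNgt => /negP; apply.
  by rewrite mulr_gt0 // dfp // (lt_trans ch).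
Qed.

Lemma is_derive_partial {R : realType} {n : nat} (f : 'rV[R]_n -> R) (y v : 'rV[R]_n) :
  differentiable f y -> is_derive y v f (\sum_a v 0 a * partial a f y).
Proof.
move=> df; apply: DeriveDef; first exact: diff_derivable.
rewrite deriveE // [v in 'd _ _ v]row_sum_delta linear_sum.
apply: eq_bigr => a _; rewrite linearZ /= /partial deriveE //.
Qed.

(** On a line the barrier is the exponential of a quadratic polynomial, which makes its derivatives
    explicit. *)
Lemma is_derive_expR_quadratic {R : realType} (a b c t : R) :
  is_derive t 1 (fun t : R => expR (a + b * t + c * t ^+ 2))
    ((b + 2 * c * t) * expR (a + b * t + c * t ^+ 2)).
Proof.
have dq : is_derive t 1 (fun t : R => a + b * t + c * t ^+ 2) (b + 2 * c * t).
  apply: is_derive_eq; rewrite ?scaler0 /GRing.scale /=; ring.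
have := is_derive1_comp (is_derive_expR _) dq.
by rewrite mulrC.
Qed.

Lemma is_derive2_expR_quadratic {R : realType} (a b c t : R) :
  is_derive t 1 (fun t : R => (b + 2 * c * t) * expR (a + b * t + c * t ^+ 2))
    ((2 * c + (b + 2 * c * t) ^+ 2) * expR (a + b * t + c * t ^+ 2)).
Proof.
have d1 := is_derive_expR_quadratic a b c t.
have d2 : is_derive t 1 (fun t : R => b + 2 * c * t) (2 * c).
  by apply: is_derive_eq; rewrite ?scaler0 /GRing.scale /=; ring.
by apply: is_derive_eq (is_deriveM d2 d1) _; rewrite /GRing.scale /=; ring.
Qed.

(** * The strong maximum principle *)

Definition sqn {R : pzRingType} {n : nat} (v : 'rV[R]_n) : R := \sum_i v 0 i ^+ 2.

Lemma sqn_line {R : comPzRingType} {n : nat} (v w : 'rV[R]_n) (t : R) :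
  sqn (v + t *: w) = sqn v + 2 * (\sum_i v 0 i * w 0 i) * t + sqn w * t ^+ 2.
Proof.
rewrite /sqn mulr_sumr !mulr_suml -!big_split /=; apply: eq_bigr => i _.
by rewrite !mxE; ring.
Qed.

Lemma near_line {R : realType} {n : nat} (z v : 'rV[R]_n) (P : set 'rV[R]_n) :
  nbhs z P -> \forall t \near (0 : R), P (z + t *: v).
Proof.
move=> Pz; have : {for (0 : R), continuous (fun t : R => z + t *: v)}.
  apply: continuousD; first exact: cst_continuous.
  exact: scalel_continuous.
by move=> /(_ P); rewrite /= scale0r addr0; apply.
Qed.

Lemma Ck_line_derivatives {R : realType} {n : nat} {U : set 'rV[R]_n}
    {u : 'rV[R]_n -> R} {z : 'rV[R]_n} (v : 'rV[R]_n) :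
  open U -> Ck 2 U u -> U z ->
  (\forall t \near (0 : R), is_derive (t : R) 1 (fun t : R => u (z + t *: v))
     (\sum_a v 0 a * partial a u (z + t *: v))) /\
  is_derive (0 : R) 1 (fun t : R => \sum_a v 0 a * partial a u (z + t *: v))
     (\sum_b \sum_a v 0 a * partial a (partial b u) z * v 0 b).
Proof.
move=> oU [cu u2] Uz; split.
  have Un : nbhs z U by exact: open_nbhs_nbhs.
  apply: filterS (near_line z v U Un) => t Ut.
  apply/is_derive_line/is_derive_partial; apply: (C1_differentiable oU _ Ut).
  split=> // a; have [du [cdu _]] := u2 a; split=> //.
have D a : is_derive (0 : R) 1 (fun t : R => partial a u (z + t *: v))
    (\sum_b v 0 b * partial b (partial a u) z).
  have [_ C1] := u2 a.
  have := is_derive_partial _ _ v (C1_differentiable oU C1 Uz).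
  rewrite -{1}[z]addr0 -(scale0r v).
  exact: is_derive_line.
have -> : (fun t : R => \sum_a v 0 a * partial a u (z + t *: v)) =
   \sum_a (fun t : R => v 0 a *: partial a u (z + t *: v)).
  by apply/funext => t; rewrite fct_sumE.
have DZ a := is_deriveZ (v 0 a) (D a).
apply: is_derive_eq (is_derive_sum DZ) _.
apply: eq_bigr => b _; rewrite scaler_sumr; apply: eq_bigr => a _.
by rewrite /GRing.scale /= mulrC.
Qed.

Definition barrier {R : realType} {n : nat} (al : R) (q y : 'rV[R]_n) : R :=
  expR (- (al * sqn (y - q))).

(** One-variable derivative tests along every line through [z]: the gradient of [u] cancels that of
    [e] times the barrier, and the Hessian of the sum is non-positive as a quadratic form. *)
Lemma derivatives_at_barrier_max {R : realType} {n : nat} {U : set 'rV[R]_n}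
    {u : 'rV[R]_n -> R} {z q : 'rV[R]_n} {al e : R} :
  open U -> Ck 2 U u -> U z ->
  (\forall y \near z, u y + e * barrier al q y <= u z + e * barrier al q z) ->
  (forall a, partial a u z = e * barrier al q z * (2 * al * (z - q) 0 a)) /\
  forall v : 'rV[R]_n,
    \sum_b \sum_a v 0 a * partial a (partial b u) z * v 0 b +
    e * barrier al q z *
     (4 * al ^+ 2 * (\sum_a (z - q) 0 a * v 0 a) ^+ 2 - 2 * al * sqn v) <= 0.
Proof.
move=> oU u2 Uz umax.
have main (v : 'rV[R]_n) : \sum_a v 0 a * partial a u z =
      e * barrier al q z * (2 * al * \sum_a (z - q) 0 a * v 0 a) /\
    \sum_b \sum_a v 0 a * partial a (partial b u) z * v 0 b +
    e * barrier al q z *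
     (4 * al ^+ 2 * (\sum_a (z - q) 0 a * v 0 a) ^+ 2 - 2 * al * sqn v) <= 0.
  set s := \sum_a (z - q) 0 a * v 0 a.
  have [du d2u] := Ck_line_derivatives v oU u2 Uz.
  have barE (t : R) : barrier al q (z + t *: v) =
      expR (- (al * sqn (z - q)) + - (2 * al * s) * t + - (al * sqn v) * t ^+ 2).
    rewrite /barrier addrAC sqn_line; congr expR; rewrite -/s; ring.
  have barE0 : barrier al q z =
      expR (- (al * sqn (z - q)) + - (2 * al * s) * 0 + - (al * sqn v) * 0 ^+ 2).
    by rewrite -barE scale0r addr0.
  have [||| D1 D2] := @second_derivative_at_max R
    (fun t => u (z + t *: v) + e *: barrier al q (z + t *: v))
    (fun t => (\sum_a v 0 a * partial a u (z + t *: v)) +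
       e *: ((- (2 * al * s) + 2 * - (al * sqn v) * t) * expR (- (al * sqn (z - q))
            + - (2 * al * s) * t + - (al * sqn v) * t ^+ 2)))
    (\sum_b \sum_a v 0 a * partial a (partial b u) z * v 0 b
       + e *: ((2 * - (al * sqn v) + (- (2 * al * s) + 2 * - (al * sqn v) * 0) ^+ 2) *
            expR (- (al * sqn (z - q))
            + - (2 * al * s) * 0 + - (al * sqn v) * 0 ^+ 2))).
  - apply: filterS du => t du; apply: is_deriveD; apply: is_deriveZ.
    under [X in is_derive _ _ X _]eq_fun do rewrite barE.
    exact: is_derive_expR_quadratic.
  - apply: is_deriveD; apply: is_deriveZ; exact: is_derive2_expR_quadratic.
  - apply: filterS (near_line z v _ umax) => t /=.
    by rewrite scale0r addr0.
  move: D1 D2; rewrite -barE0 scale0r addr0 /GRing.scale /= => D1 D2; split.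
    by apply/eqP; rewrite -subr_eq0; apply/eqP; rewrite -[RHS]D1; ring.
  by apply: le_trans D2; rewrite le_eqVlt; apply/orP; left; apply/eqP; ring.
split=> [a|v]; last by case: (main v).
have [+ _] := main (basis_vec R a).
rewrite (bigD1 a) //= big1 => [|i ia]; last by rewrite !mxE (negbTE ia) mul0r.
rewrite (bigD1 a) //= big1 => [|i ia]; last by rewrite !mxE (negbTE ia) mulr0.
by rewrite [basis_vec R a 0 a]mxE !eqxx mul1r mulr1 !addr0.
Qed.

Lemma sqn_ge0 {R : realDomainType} {n : nat} (v : 'rV[R]_n) : 0 <= sqn v.
Proof. by apply: sumr_ge0 => i _; apply: sqr_ge0. Qed.

Lemma sqn_eq0 {R : realDomainType} {n : nat} (v : 'rV[R]_n) : (sqn v == 0) = (v == 0).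
Proof.
rewrite psumr_eq0; last by move=> i _; apply: sqr_ge0.
apply/allP/eqP => [v0|-> i _]; last by rewrite mxE expr0n eqxx.
apply/rowP => i; rewrite mxE.
by have := v0 i; rewrite mem_index_enum sqrf_eq0 => /(_ isT)/eqP.
Qed.

Lemma sqn_gt0 {R : realDomainType} {n : nat} (v : 'rV[R]_n) : (0 < sqn v) = (v != 0).
Proof. by rewrite lt0r sqn_ge0 andbT sqn_eq0. Qed.

(** Only bounds on [A] are recorded, so that [A] may depend on the point and on [u] itself; this
    lets a quasilinear equation be treated as a linear one. The same [L] bounds the trace and the
    first order coefficients. *)
Definition elliptic_ineq {R : realType} {n : nat} (lam L : R)
    (u : 'rV[R]_n -> R) (y : 'rV[R]_n) : Prop :=
  exists A : 'M[R]_n, [/\ A^T = A,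
    forall v : 'rV[R]_n, lam * sqn v <= (v *m A *m v^T) 0 0,
    \tr A <= L &
    0 <= \sum_a \sum_b A a b * partial a (partial b u) y
         + L * \sum_a `|partial a u y|].

(** Contracting the Hessian bound with [A] and dividing by [2 al k] gives
    [s (2 al lam - L) <= L (1 + n)], the negation of the assumed inequality. The gain [4 al^2 lam s]
    is quadratic in [al], while the losses from the trace and from the first order terms are
    linear. *)
Lemma elliptic_no_barrier_max {R : realType} {n : nat} {U : set 'rV[R]_n}
    {u : 'rV[R]_n -> R} {z q : 'rV[R]_n} {al e lam L : R} :
  open U -> Ck 2 U u -> U z ->
  0 < al -> 0 < e -> 0 < lam -> 0 < L ->
  L * (1 + n%:R) < sqn (z - q) * (2 * al * lam - L) ->
  elliptic_ineq lam L u z ->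
  (\forall y \near z, u y + e * barrier al q y <= u z + e * barrier al q z) ->
  False.
Proof.
move=> oU u2 Uz al0 e0 lam0 L0 big [A [sA lamA trA ineq]] umax.
have [D1 D2] := derivatives_at_barrier_max oU u2 Uz umax.
set s := sqn (z - q) in big; set k := e * barrier al q z in D1 D2.
have k0 : 0 < k by rewrite mulr_gt0 ?expR_gt0 //.
have pA : posdef A.
  by split=> // v v0; apply: lt_le_trans (lamA v); rewrite mulr_gt0 // sqn_gt0.
pose d := z - q.
pose H := \matrix_(a, b) (partial a (partial b u) z
  + k * (4 * al ^+ 2 * d 0 a * d 0 b - 2 * al * (a == b)%:R)).
have /(posdef_contract_le0 pA) : forall v : 'rV[R]_n, (v *m H *m v^T) 0 0 <= 0.
  move=> v; rewrite mulmx_form; apply: le_trans (D2 v).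
  rewrite le_eqVlt; apply/orP; left; apply/eqP.
  rewrite exchange_big /=.
  have -> : (\sum_a d 0 a * v 0 a) ^+ 2 =
      \sum_b \sum_a d 0 a * v 0 a * (d 0 b * v 0 b).
    rewrite expr2 mulr_sumr; apply: eq_bigr => b _; by rewrite mulr_suml.
  have -> : sqn v = \sum_b \sum_a v 0 a * (a == b)%:R * v 0 b.
    apply: eq_bigr => b _; rewrite (bigD1 b) //= big1 => [|a ab].
      by rewrite eqxx mulr1 addr0.
    by rewrite (negbTE ab) mulr0 mul0r.
  rewrite !mulr_sumr -sumrB mulr_sumr -big_split /=; apply: eq_bigr => b _.
  rewrite !mulr_sumr -sumrB mulr_sumr -big_split /=; apply: eq_bigr => a _.
  by rewrite mxE; ring.
have -> : \sum_a \sum_b A a b * H a b =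
   \sum_a \sum_b A a b * partial a (partial b u) z
   + k * (4 * al ^+ 2 * (d *m A *m d^T) 0 0 - 2 * al * \tr A).
  have -> : \tr A = \sum_a \sum_b A a b * (a == b)%:R.
    apply: eq_bigr => a _; rewrite (bigD1 a) //= big1 => [|b ab].
      by rewrite eqxx mulr1 addr0.
    by rewrite eq_sym (negbTE ab) mulr0.
  rewrite mulmx_form !mulr_sumr -sumrB mulr_sumr -big_split /=; apply: eq_bigr => a _.
  rewrite !mulr_sumr -sumrB mulr_sumr -big_split /=; apply: eq_bigr => b _.
  by rewrite mxE; ring.
have kal : 0 < k * 2 * al by rewrite -mulrA (mulr_gt0 k0) // mulr_gt0.
(* The crude bound [|d_a| <= 1 + d_a^2] keeps the estimate polynomial in [s]. *)
have du : \sum_a `|partial a u z| <= k * (2 * al) * (n%:R + s).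
  have -> : n%:R + s = \sum_a (1 + d 0 a ^+ 2).
    by rewrite big_split /= sumr_const card_ord.
  rewrite mulr_sumr; apply: ler_sum => a _; rewrite D1 -/d
    (normrM k) (normrM (2 * al)) (normrM 2 al).
  rewrite (gtr0_norm k0) (gtr0_norm al0) ger0_norm // !mulrA (ler_pM2l kal).
  have := sqr_ge0 (`|d 0 a| - 1); rewrite sqrrB real_normK ?num_real //; nra.
have := lamA d; rewrite -/s.
set Q := (d *m A *m d^T) 0 0; set S := \sum_a \sum_b _ in ineq *.
set T := \sum_a `|_| in ineq du * => dQ h.
have h1 : L * T <= L * (k * (2 * al) * (n%:R + s)) by rewrite ler_pM2l.
have h2 : k * (4 * al ^+ 2 * (lam * s) - 2 * al * L)
   <= k * (4 * al ^+ 2 * Q - 2 * al * \tr A).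
  have a4 : 0 < 4 * al ^+ 2 by rewrite mulr_gt0 ?exprn_gt0.
  have a2 : 0 < 2 * al by rewrite mulr_gt0.
  by rewrite (ler_pM2l k0) lerB ?(ler_pM2l a4) ?(ler_pM2l a2).
have h3 : k * (4 * al ^+ 2 * (lam * s) - 2 * al * L) - L * (k * (2 * al) * (n%:R + s)) <= 0.
  lra.
have h4 : (2 * al * k) * (s * (2 * al * lam - L) - L * (1 + n%:R)) <= 0.
  by apply: le_trans h3; rewrite le_eqVlt; apply/orP; left; apply/eqP; ring.
move: h4; rewrite leNgt => /negP; apply.
by rewrite mulr_gt0 ?subr_gt0 // mulr_gt0 // mulr_gt0.
Qed.

(** * Euclidean balls and the touching ball argument *)

Lemma sqnD_le {R : realDomainType} {n : nat} (v w : 'rV[R]_n) :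
  sqn (v + w) <= 2 * sqn v + 2 * sqn w.
Proof.
rewrite /sqn !mulr_sumr -big_split /=; apply: ler_sum => i _.
by rewrite mxE; have := sqr_ge0 (v 0 i - w 0 i); nra.
Qed.

Lemma sqnN {R : pzRingType} {n : nat} (v : 'rV[R]_n) : sqn (- v) = sqn v.
Proof. by apply: eq_bigr => i _; rewrite mxE sqrrN. Qed.

Lemma continuous_sqnB {R : realType} {n : nat} (c : 'rV[R]_n) :
  continuous (fun y : 'rV[R]_n => sqn (y - c)).
Proof.
have -> : (fun y : 'rV[R]_n => sqn (y - c)) =
    \sum_i (fun y : 'rV[R]_n => (y 0 i - c 0 i) * (y 0 i - c 0 i)).
  apply/funext => h; rewrite fct_sumE; apply: eq_bigr => i _.
  by rewrite !mxE expr2.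
move=> x; elim/big_ind : _ => [|f g cf cg|i _]; first exact: cst_continuous.
  exact: continuousD.
have cB : {for x, continuous (fun y : 'rV[R]_n => y 0 i - c 0 i)}.
  by apply: continuousB; [exact: coord_continuous|exact: cst_continuous].
by apply: (continuousM cB cB).
Qed.

Lemma continuous_barrier {R : realType} {n : nat} (al : R) (q : 'rV[R]_n) :
  continuous (barrier al q).
Proof.
move=> x.
have cx : {for x, continuous (fun y : 'rV[R]_n => - (al * sqn (y - q)))}.
  apply: continuousN; apply: continuousM; first exact: cst_continuous.
  exact: continuous_sqnB.
exact: (continuous_comp cx (@continuous_expR R _)).
Qed.

Lemma compact_sqn_ball {R : realType} {n : nat} (c : 'rV[R]_n) (r : R) :
  compact [set y : 'rV[R]_n | sqn (y - c) <= r].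
Proof.
apply: bounded_closed_compact; last first.
  by apply: (preimage_closed (D := [set x : R | x <= r]));
    [move=> y _; exact: continuous_sqnB|exact: closed_le].
exists (`|c| + (1 + r)); split; first exact: num_real.
move=> M rM y /= yr; apply: le_trans (ltW rM).
have r0 : 0 <= r by apply: le_trans yr; exact: sqn_ge0.
rewrite -(subrK c y) addrC (le_trans (ler_normD _ _)) // lerD2l.
apply: norm_leP => [|i]; first by rewrite addr_ge0.
have : (y - c) 0 i ^+ 2 <= r.
  apply: le_trans yr; rewrite /sqn (bigD1 i) //= lerDl.
  by apply: sumr_ge0 => j _; apply: sqr_ge0.
set t := (y - c) 0 i => tr.
have := sqr_ge0 (`|t| - 1); rewrite sqrrB real_normK ?num_real //; nra.
Qed.

Lemma closed_superlevel {T : topologicalType} {R : realType} {B : set T}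
    {u : T -> R} (m : R) : closed B -> (forall y, B y -> {for y, continuous u}) ->
  closed [set y | B y /\ m <= u y].
Proof.
move=> cB cu; rewrite -[X in closed X]setCK; apply: open_closedC.
rewrite openE => y /= nK; rewrite /interior.
have [By|nBy] := pselect (B y); last first.
  have : nbhs y (~` B) by apply: open_nbhs_nbhs; split=> //; exact: closed_openC.
  by apply: filterS => x nBx [].
have um : u y < m by rewrite ltNge; apply/negP => my; apply: nK.
have := cu _ By => /cvgr_lt /(_ _ um).
by apply: filterS => x ux [_]; rewrite leNgt ux.
Qed.

(** If [u y1 < m], let [z] be a point of the level set [u = m] nearest to [y1]. Near [z], adding a
    small multiple of a barrier to [u] creates an interior maximum, which [elliptic_no_barrier_max]
    excludes. The factor [10] leaves room for the auxiliary balls. *)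
Lemma strong_maximum_local {R : realType} {n : nat} {U : set 'rV[R]_n}
    {u : 'rV[R]_n -> R} {x0 : 'rV[R]_n} {r lam L m : R} :
  open U -> Ck 2 U u -> 0 < lam -> 0 < L ->
  (forall y, sqn (y - x0) <= 10 * r -> U y) ->
  (forall y, U y -> u y <= m) ->
  (forall y, sqn (y - x0) <= 10 * r -> (exists a, partial a u y != 0) ->
     elliptic_ineq lam L u y) ->
  u x0 = m ->
  forall y, sqn (y - x0) < r -> u y = m.
Proof.
move=> oU u2 lam0 L0 ballU um ell ux0 y1 y1r.
apply: contrapT => uy1.
have cu y : U y -> {for y, continuous u} by case: u2 => h _; exact: h.
have r0 : 0 < r by apply: le_lt_trans y1r; exact: sqn_ge0.
have closed_ball c s : closed [set y : 'rV[R]_n | sqn (y - c) <= s].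
  by apply: compact_closed (compact_sqn_ball c s); exact: norm_hausdorff.
(* The squared radius [4 r] ensures that every point closer to [y1] than [z] is lies in [B0], by [|y
   - x0|^2 <= 2 |y - y1|^2 + 2 |y1 - x0|^2 < 4 r]; the cut-off hides no nearer point of the level
   set. *)
pose B0 := [set y : 'rV[R]_n | sqn (y - x0) <= 4 * r].
have B0U y : B0 y -> U y by rewrite /B0 /= => yr; apply: ballU; lra.
pose K := [set y | B0 y /\ m <= u y].
have cK : compact K.
  apply: subclosed_compact (compact_sqn_ball x0 (4 * r)) _; last by move=> y [].
  by apply: (closed_superlevel m (closed_ball x0 (4 * r))) => y /B0U /cu.
have Kx0 : K x0.
  split; last by rewrite ux0.
  by rewrite /B0 /= subrr /sqn big1 => [|i _]; [lra|rewrite mxE expr0n].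
have [z] := compact_EVT_min (ex_intro _ x0 Kx0) cK
  (continuous_subspaceT (@continuous_sqnB R n y1)).
rewrite inE => -[B0z mz] zmin.
have uz : u z = m by apply/eqP; rewrite eq_le mz um //; exact: B0U.
pose D := z - y1; pose s := sqn D.
have sr : s < r.
  apply: le_lt_trans y1r; rewrite -[in leRHS]sqnN opprB; apply: zmin.
  by rewrite inE.
have s0 : 0 < s.
  rewrite sqn_gt0 subr_eq0; apply/eqP => zy1; apply: uy1; by rewrite -zy1.
(* The ball centred at the midpoint of [y1] and [z] touches [K] only at [z]. *)
pose q := y1 + 2^-1 *: D.
have subq y : y - q = (y - z) + 2^-1 *: D.
  apply/rowP => i; rewrite /q /D !mxE; lra.
have suby1 y : y - y1 = (y - z) + 1 *: D.
  by apply/rowP => i; rewrite /D !mxE; lra.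
have zq : sqn (z - q) = s / 4.
  rewrite subq subrr sqn_line -/s [sqn 0]big1 => [|i _]; last by rewrite mxE expr0n.
  by rewrite big1 => [|i _]; [lra|rewrite mxE mul0r].
have ballzU y : sqn (y - z) <= s / 16 -> sqn (y - x0) <= 10 * r.
  move=> yz; have := sqnD_le (y - z) (z - x0).
  rewrite addrA subrK; move: B0z; rewrite /B0 /=; lra.
(* On this sphere about [z], lying in the ball about [q] forces [<y - z, D> <= - s / 16], so [y] is
   strictly closer to [y1] than [z] is. *)
have touch y : sqn (y - z) = s / 16 -> sqn (y - q) <= s / 4 -> u y < m.
  rewrite subq sqn_line -/s => yz yq.
  have yy1 : sqn (y - y1) < s.
    rewrite suby1 sqn_line -/s; lra.
  rewrite ltNge; apply/negP => my.
  have : K y.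
    split => //; rewrite /B0 /=.
    have := sqnD_le (y - y1) (y1 - x0); rewrite addrA subrK; lra.
  by move=> Ky; have := zmin y; rewrite inE => /(_ Ky); rewrite leNgt yy1.
(* Compactness turns the strict inequality on this cap into a uniform gap. *)
have [e e0 eH] : exists2 e, 0 < e & forall y, sqn (y - z) = s / 16 ->
    sqn (y - q) <= s / 4 -> u y + e <= m.
  pose S := [set y : 'rV[R]_n | sqn (y - z) = s / 16] `&` [set y | sqn (y - q) <= s / 4].
  have cS : compact S.
    apply: subclosed_compact (compact_sqn_ball q (s / 4)) _; last by move=> y [].
    apply: closedI => //.
    by apply: (preimage_closed (D := [set x : R | x = s / 16]));
      [move=> y _; exact: continuous_sqnB|exact: closed_eq].
  have [S0|S0] := pselect (S !=set0); last first.
    by exists 1 => // y yz yq; exfalso; apply: S0; exists y.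
  have SU y : S y -> U y by move=> [/= yz _]; apply/ballU/ballzU; rewrite yz.
  have [|p] := @compact_EVT_max _ R u S S0 cS.
    by apply: continuous_in_subspaceT => y; rewrite inE => /SU/cu.
  rewrite inE => -[/= pz pq] pmax; exists (m - u p).
    by rewrite subr_gt0 touch.
  move=> y yz yq; have := pmax y; rewrite inE => /(_ (conj yz yq)); lra.
(* With [sqn (w - q) >= s / 16], this value yields at least [L (n + 2)], above the [L (n + 1)] to be
   beaten. *)
have [al al0 alE] : exists2 al, 0 < al & 2 * al * lam - L = 16 * L * (n%:R + 2) / s.
  exists ((L + 16 * L * (n%:R + 2) / s) / (2 * lam)).
    by rewrite divr_gt0 ?mulr_gt0 // addr_gt0 ?divr_gt0 ?mulr_gt0 // ltr_wpDl.
  by field; rewrite !gt_eqF.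
pose b := barrier al q.
have b_lt y w : sqn (w - q) < sqn (y - q) -> b y < b w.
  by move=> yw; rewrite /b /barrier ltr_expR ltrN2 ltr_pM2l.
pose C := [set y : 'rV[R]_n | sqn (y - z) <= s / 16].
have Cz : C z.
  rewrite /C /= subrr /sqn big1 => [|i _]; [lra|by rewrite mxE expr0n].
have CU y : C y -> U y by move=> /ballzU/ballU.
have [|w] := @compact_EVT_max _ R (fun y => u y + e * b y) C
    (ex_intro _ z Cz) (compact_sqn_ball z (s / 16)).
  apply: continuous_in_subspaceT => y; rewrite inE => /CU/cu cuy.
  have cb : {for y, continuous (fun y : 'rV[R]_n => e * b y)}.
    apply: continuousM; first exact: cst_continuous.
    exact: continuous_barrier.
  exact: (continuousD cuy cb).
rewrite inE => Cw wmax.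
have Uw := CU _ Cw.
(* The maximum is not on the sphere: in the ball about [q] the gap [e] offsets a barrier that is at
   most [1], and outside it the barrier is below its value at [z]. *)
have wz : sqn (w - z) < s / 16.
  rewrite lt_neqAle Cw andbT; apply/eqP => wz.
  have : u z + e * b z <= u w + e * b w by apply: wmax; rewrite inE.
  apply/negP; rewrite -ltNge uz.
  have [wq|wq] := leP (sqn (w - q)) (s / 4).
    have bw : b w <= 1.
      by rewrite expR_le1 oppr_le0 mulr_ge0 ?sqn_ge0 // ltW.
    have bz : 0 < b z by exact: expR_gt0.
    have := eH _ wz wq; nra.
  have : b w < b z by apply: b_lt; rewrite zq.
  have := um _ Uw; nra.
(* The small ball about [z] has half the radius of the ball about [q], hence stays away from [q],
   the critical point of the barrier. *)
have wq : s / 16 <= sqn (w - q).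
  have := sqnD_le (w - q) (z - w); rewrite [w - q + _]addrC addrA subrK zq.
  rewrite -[sqn (z - w)]sqnN opprB; lra.
have near_max : \forall y \near w, u y + e * b y <= u w + e * b w.
  have : \forall y \near w, sqn (y - z) < s / 16.
    exact: (cvgr_lt _ (continuous_sqnB z w)).
  by apply: filterS => y yz; apply: wmax; rewrite inE; exact: ltW.
have [D1 _] := derivatives_at_barrier_max oU u2 Uw near_max.
have dw : exists a, partial a u w != 0.
  apply: contrapT => nd.
  have : sqn (w - q) = 0.
    rewrite /sqn big1 // => a _.
    have /eqP : partial a u w = 0.
      by apply/eqP/negPn/negP => h; apply: nd; exists a.
    rewrite D1 !mulf_eq0 (gt_eqF e0) (gt_eqF al0) gt_eqF ?expR_gt0 //=.
    by rewrite pnatr_eq0 /= => /eqP ->; rewrite expr0n.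
  by move=> E; move: wq; rewrite E; lra.
apply: (elliptic_no_barrier_max oU u2 Uw al0 e0 lam0 L0 _ _ near_max).
  rewrite alE; apply: (@lt_le_trans _ _ (s / 16 * (16 * L * (n%:R + 2) / s))).
    have -> : s / 16 * (16 * L * (n%:R + 2) / s) = L * (n%:R + 2).
      by field; rewrite gt_eqF.
    by rewrite ltr_pM2l //; lra.
  apply: ler_wpM2r wq; apply: divr_ge0 (ltW s0).
  by rewrite !mulr_ge0 ?ltW // addr_ge0.
by apply: ell => //; apply: ballzU.
Qed.

(** * Algebra of C^1 functions *)

Lemma for_continuous_near_eq {T U : topologicalType} {f g : T -> U} {x : T} :
  (\forall y \near x, f y = g y) -> {for x, continuous g} -> {for x, continuous f}.
Proof.
move=> fg cg; have fgx : f x = g x by exact: (nbhs_singleton fg).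
rewrite /prop_for /continuous_at fgx; apply: cvg_trans cg.
by apply: near_eq_cvg; apply: filterS fg => y ->.
Qed.

Lemma is_derive_comp_real {R : realType} {V : normedModType R} {F : R -> R}
    {f : V -> R} {y v : V} {dF d : R} :
  is_derive (f y) 1 F dF -> differentiable f y -> is_derive y v f d ->
  is_derive y v (fun z => F (f z)) (dF * d).
Proof.
move=> [/derivable1_diffP DF dFE] Df [_ dE].
have DFf : differentiable (F \o f) y by exact: differentiable_comp.
apply: DeriveDef; first exact: diff_derivable.
rewrite (deriveE _ DFf) diff_comp //= -(deriveE _ Df) dE.
by rewrite -[d]mulr1 [LHS]linearZ /= -deriveE // dFE /GRing.scale /= mulr1 mulrC.
Qed.

Section C1_algebra.
Context {R : realType} {n : nat} {U : set 'rV[R]_n}.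
Hypothesis oU : open U.
Implicit Types f g : 'rV[R]_n -> R.

Let near_U y : U y -> \forall z \near y, U z.
Proof. by move=> Uy; exact: open_nbhs_nbhs. Qed.

(** [Ck] speaks of the total function [partial]; with an existential derivative, closure properties
    can exhibit a formula instead. As [U] is open, the formula agrees with [partial] near each point
    and passes its continuity on. *)
Lemma C1P f : Ck 1 U f <->
  (forall y, U y -> {for y, continuous f}) /\
  forall a, exists d : 'rV[R]_n -> R,
    (forall y, U y -> is_derive y (basis_vec R a) f (d y)) /\
    (forall y, U y -> {for y, continuous d}).
Proof.
split=> -[cf df]; split=> // a.
  have [da [cd _]] := df a; exists (partial a f); split=> // y Uy.
  exact/derivableP/da.
have [d [dd cd]] := df a; split=> [y /dd[]//|]; split=> // y Uy.
apply: for_continuous_near_eq (cd y Uy).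
by apply: filterS (near_U y Uy) => z /dd[].
Qed.

Lemma C1_eq f g : (forall y, U y -> f y = g y) -> Ck 1 U g -> Ck 1 U f.
Proof.
move=> fg /C1P[cg dg]; have nfg y : U y -> \forall z \near y, f z = g z.
  by move=> Uy; apply: filterS (near_U y Uy) => z /fg.
apply/C1P; split=> [y Uy|a].
  exact: for_continuous_near_eq (nfg y Uy) (cg y Uy).
have [d [dd cd]] := dg a; exists d; split=> // y Uy.
apply: near_eq_is_derive (dd y Uy).
by apply: filterS (nfg y Uy) => z ->.
Qed.

Lemma C1_cst (c : R) : Ck 1 U (fun=> c).
Proof.
apply/C1P; split=> [y _|a]; first exact: cst_continuous.
exists (fun=> 0); split=> y _; first exact: is_derive_cst.
exact: cst_continuous.
Qed.

Lemma C1D f g : Ck 1 U f -> Ck 1 U g -> Ck 1 U (fun y => f y + g y).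
Proof.
move=> /C1P[cf df] /C1P[cg dg]; apply/C1P; split=> [y Uy|a].
  exact: (continuousD (cf y Uy) (cg y Uy)).
have [d [dd cd]] := df a; have [d' [dd' cd']] := dg a.
exists (fun y => d y + d' y); split=> y Uy.
  exact: (is_deriveD (dd y Uy) (dd' y Uy)).
exact: (continuousD (cd y Uy) (cd' y Uy)).
Qed.

Lemma C1M f g : Ck 1 U f -> Ck 1 U g -> Ck 1 U (fun y => f y * g y).
Proof.
move=> /C1P[cf df] /C1P[cg dg]; apply/C1P; split=> [y Uy|a].
  exact: (continuousM (cf y Uy) (cg y Uy)).
have [d [dd cd]] := df a; have [d' [dd' cd']] := dg a.
exists (fun y => f y * d' y + g y * d y); split=> y Uy.
  exact: (is_deriveM (dd y Uy) (dd' y Uy)).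
exact: (continuousD (continuousM (cf y Uy) (cd' y Uy))
  (continuousM (cg y Uy) (cd y Uy))).
Qed.

Lemma C1_comp (F dF : R -> R) f :
  (forall y, U y -> is_derive (f y) 1 F (dF (f y))) ->
  (forall y, U y -> {for f y, continuous dF}) ->
  Ck 1 U f -> Ck 1 U (fun y => F (f y)).
Proof.
move=> dFf cdF Cf; have /C1P[cf df] := Cf.
have cF y : U y -> {for f y, continuous F}.
  by move=> /dFf[h _]; exact/differentiable_continuous/derivable1_diffP.
apply/C1P; split=> [y Uy|a].
  exact: (continuous_comp (cf y Uy) (cF y Uy)).
have [d [dd cd]] := df a; exists (fun y => dF (f y) * d y); split=> y Uy; last first.
  exact: (continuousM (continuous_comp (cf y Uy) (cdF y Uy)) (cd y Uy)).
exact: is_derive_comp_real (dFf y Uy) (C1_differentiable oU Cf Uy) (dd y Uy).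
Qed.

Lemma C1_sum (I : Type) (s : seq I) (F : I -> 'rV[R]_n -> R) :
  (forall i, Ck 1 U (F i)) -> Ck 1 U (fun y => \sum_(i <- s) F i y).
Proof.
move=> CF; elim: s => [|i s IH].
  by apply: C1_eq (C1_cst 0) => y _; rewrite big_nil.
by apply: C1_eq (C1D _ _ (CF i) IH) => y _; rewrite big_cons.
Qed.

Lemma C1_prod (I : Type) (s : seq I) (F : I -> 'rV[R]_n -> R) :
  (forall i, Ck 1 U (F i)) -> Ck 1 U (fun y => \prod_(i <- s) F i y).
Proof.
move=> CF; elim: s => [|i s IH].
  by apply: C1_eq (C1_cst 1) => y _; rewrite big_nil.
by apply: C1_eq (C1M _ _ (CF i) IH) => y _; rewrite big_cons.
Qed.

Lemma C1V f : (forall y, U y -> f y != 0) -> Ck 1 U f -> Ck 1 U (fun y => (f y)^-1).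
Proof.
move=> f0; apply: (C1_comp (fun x => x^-1) (fun x => - x ^- 2)) => y /f0 fy0.
  have did : derivable (@id R) (f y) 1 by exact: derivable_id.
  apply: DeriveDef; first exact: (derivableV fy0 did).
  by rewrite (deriveV fy0 did) derive_id /GRing.scale /= mulr1.
apply: continuousN; apply: continuousV; first by rewrite expf_neq0.
exact: exprn_continuous.
Qed.

Lemma C1_sqrt f : (forall y, U y -> 0 < f y) -> Ck 1 U f ->
  Ck 1 U (fun y => Num.sqrt (f y)).
Proof.
move=> f0; apply: (C1_comp Num.sqrt (fun x => (2 * Num.sqrt x)^-1)) => y /f0 fy0.
  exact: is_derive1_sqrt.
apply: continuousV; first by rewrite mulf_neq0 // gt_eqF // sqrtr_gt0.
by apply: continuousM; [exact: cst_continuous|exact: sqrt_continuous].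
Qed.

Lemma C1_det (k : nat) (A : 'rV[R]_n -> 'M[R]_k) :
  (forall i j, Ck 1 U (fun y => A y i j)) -> Ck 1 U (fun y => \det (A y)).
Proof.
move=> CA; rewrite /determinant; apply: C1_sum => s.
by apply: C1M; [exact: C1_cst|exact: C1_prod].
Qed.

(** Cramer's rule: an entry of the inverse is a cofactor divided by the non-vanishing
    determinant. *)
Lemma C1_invmx (k : nat) (A : 'rV[R]_n -> 'M[R]_k) i j :
  (forall y, U y -> A y \in unitmx) ->
  (forall i j, Ck 1 U (fun y => A y i j)) -> Ck 1 U (fun y => invmx (A y) i j).
Proof.
move=> uA CA.
have E y : U y -> invmx (A y) i j = (\det (A y))^-1 * cofactor (A y) j i.
  by move=> Uy; rewrite /invmx uA // !mxE.
apply: (C1_eq _ _ E); apply: C1M.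
  by apply: C1V (C1_det _ _ CA) => y /uA; rewrite unitmxE unitfE.
rewrite /cofactor; apply: C1M; first exact: C1_cst.
apply: C1_det => i' j'; apply: C1_eq (CA (lift j i') (lift i j')) => y _.
by rewrite !mxE.
Qed.

End C1_algebra.

(** * The coefficient matrix *)

Lemma posdef_unitmx {R : realFieldType} {n : nat} {G : 'M[R]_n} :
  posdef G -> G \in unitmx.
Proof.
move=> [_ pG]; rewrite unitmxE unitfE; apply/negP => /det0P[v v0 vG].
by have := pG v v0; rewrite vG mul0mx mxE ltxx.
Qed.

Lemma posdef_invmx {R : realFieldType} {n : nat} {G : 'M[R]_n} :
  posdef G -> posdef (invmx G).
Proof.
move=> pG; have uG := posdef_unitmx pG; have [sG pG'] := pG.
have sI : (invmx G)^T = invmx G by rewrite trmx_inv sG.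
split=> // v v0.
have -> : v *m invmx G *m v^T = (v *m invmx G) *m G *m (v *m invmx G)^T.
  by rewrite trmx_mul sI -[v *m invmx G *m G]mulmxA mulVmx // mulmx1 mulmxA.
apply: pG'; apply: contra v0 => /eqP/(congr1 (mulmx^~ G)).
by rewrite /= mul0mx -mulmxA mulVmx // mulmx1 => ->.
Qed.

(** The factor [n.+1] is positive even for [n = 0]; it later becomes a denominator. *)
Lemma form_le_sqn {R : realDomainType} {n : nat} {G : 'M[R]_n} {K : R} (v : 'rV[R]_n) :
  0 <= K -> (forall a b, `|G a b| <= K) ->
  (v *m G *m v^T) 0 0 <= K * n.+1%:R * sqn v.
Proof.
move=> K0 GK.
have le2 a b : 2 * (v 0 a * G a b * v 0 b) <= K * v 0 a ^+ 2 + K * v 0 b ^+ 2.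
  rewrite -mulrDr; apply: le_trans (ler_norm _) _.
  have -> : 2 * (v 0 a * G a b * v 0 b) = G a b * (2 * (v 0 a * v 0 b)) by ring.
  rewrite normrM ler_pM // ler_norml; apply/andP; split.
    by have := sqr_ge0 (v 0 a + v 0 b); nra.
  by have := sqr_ge0 (v 0 a - v 0 b); nra.
have Kns : 0 <= K * sqn v by rewrite mulr_ge0 // sqn_ge0.
rewrite -(ler_pM2l (ltr0n R 2)) mulmx_form.
apply: (@le_trans _ _ (\sum_a \sum_b (K * v 0 a ^+ 2 + K * v 0 b ^+ 2))).
  by rewrite mulr_sumr; apply: ler_sum => a _; rewrite mulr_sumr; apply: ler_sum.
have -> : \sum_a \sum_b (K * v 0 a ^+ 2 + K * v 0 b ^+ 2) = 2 * (K * n%:R * sqn v).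
  have E a : \sum_(b < n) (K * v 0 a ^+ 2 + K * v 0 b ^+ 2) =
      (K * v 0 a ^+ 2) *+ n + K * sqn v.
    by rewrite big_split /= sumr_const card_ord -mulr_sumr.
  under eq_bigr do rewrite E.
  rewrite big_split /= sumr_const card_ord sumrMnl -mulr_sumr -/(sqn v).
  by rewrite -[(K * _) *+ n]mulr_natr; ring.
by rewrite -addn1 natrD; nra.
Qed.

(** Cauchy-Schwarz for [G] between [v G^-1] and [v] gives [(sqn v)^2 <= (v G^-1 v^T) (v G v^T)]: an
    upper bound on the entries of [G] bounds its inverse from below. *)
Lemma invmx_form_ge {R : realFieldType} {n : nat} {G : 'M[R]_n} {K : R} (v : 'rV[R]_n) :
  posdef G -> 0 < K -> (forall a b, `|G a b| <= K) ->
  sqn v <= K * n.+1%:R * (v *m invmx G *m v^T) 0 0.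
Proof.
move=> pG K0 GK; have [->|v0] := eqVneq v 0.
  by rewrite mul0mx mul0mx [in leRHS]mxE mulr0 /sqn big1 // => i _; rewrite mxE expr0n.
have [sI _] := posdef_invmx pG.
have := posdef_CauchySchwarz (v *m invmx G) v pG.
have E : (v *m invmx G) *m G = v by rewrite -mulmxA mulVmx ?posdef_unitmx // mulmx1.
rewrite E trmx_mul sI mulmxA.
have -> : (v *m v^T) 0 0 = sqn v.
  by rewrite mxE; apply: eq_bigr => i _; rewrite mxE expr2.
move=> CS; have sv : 0 < sqn v by rewrite sqn_gt0.
rewrite -(ler_pM2r sv) -expr2 (le_trans CS) // mulrAC mulrC ler_wpM2r //.
  by apply: posdef_ge0; exact: posdef_invmx.
by apply: form_le_sqn => //; exact: ltW.
Qed.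

(** In the application [w] is the differential of [u], [H] the inverse metric and [gr] the gradient.
    By Cauchy-Schwarz [c^2 / q] lies between [0] and [Q], so [Q + 2 th c^2 / q] is at least [Q] or
    [(1 + 2 th) Q] according to the sign of [th]; [b1 > -1/2] makes the resulting factor
    positive. *)
Lemma rank_one_perturbation {R : realFieldType} {n : nat} {H : 'M[R]_n}
    {w : 'rV[R]_n} {th b1 b2 : R} :
  posdef H -> w != 0 -> - (1 / 2) < b1 -> b1 <= th <= b2 ->
  let q := (w *m H *m w^T) 0 0 in
  let gr := w *m H in
  let A := H + (2 * th / q) *: (gr^T *m gr) in
  [/\ A^T = A,
     forall v : 'rV[R]_n, Num.min 1 (1 + 2 * b1) * (v *m H *m v^T) 0 0 <=
       (v *m A *m v^T) 0 0 &
     \tr A <= (1 + 2 * (`|b1| + `|b2|)) * \tr H].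
Proof.
move=> pH w0 b1gt /andP[b1t tb2] q gr A.
have [sH pH'] := pH; have q0 : 0 < q by exact: pH'.
have CS (v : 'rV[R]_n) : ((gr *m v^T) 0 0) ^+ 2 <= q * (v *m H *m v^T) 0 0.
  exact: posdef_CauchySchwarz.
split.
- by rewrite /A linearD linearZ /= (trmx_mul gr^T) trmxK sH.
- move=> v; have Qv := posdef_ge0 v pH.
  have -> : (v *m A *m v^T) 0 0 = (v *m H *m v^T) 0 0
      + 2 * th / q * ((gr *m v^T) 0 0) ^+ 2.
    rewrite /A mulmxDr mulmxDl -scalemxAr -scalemxAl [LHS]mxE; congr (_ + _).
    rewrite mxE; congr (_ * _).
    have -> : v *m (gr^T *m gr) *m v^T = (gr *m v^T)^T *m (gr *m v^T).
      by rewrite (trmx_mul gr) trmxK !mulmxA.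
    by rewrite mxE big_ord1 [X in X * _]mxE expr2.
  set Q := (v *m H *m v^T) 0 0 in Qv CS *; set c := (gr *m v^T) 0 0.
  have cq : 0 <= c ^+ 2 / q <= Q.
    rewrite divr_ge0 ?sqr_ge0 ?(ltW q0) //= ler_pdivrMr // mulrC; exact: CS.
  have -> : 2 * th / q * c ^+ 2 = 2 * th * (c ^+ 2 / q) by rewrite mulrAC mulrA.
  move: cq; set t := c ^+ 2 / q => /andP[t0 tQ].
  have : Num.min 1 (1 + 2 * b1) <= 1 by rewrite ge_min lexx.
  have : Num.min 1 (1 + 2 * b1) <= 1 + 2 * b1 by rewrite ge_min lexx orbT.
  set k := Num.min _ _ => k1 k2.
  have [th0|th0] := leP 0 th; first by nra.
  have : 0 <= (Q - t) * (- th) by rewrite mulr_ge0 ?subr_ge0 // oppr_ge0 ltW.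
  have : 0 <= (th - b1) * Q by rewrite mulr_ge0 // subr_ge0.
  have : 0 <= (1 + 2 * b1 - k) * Q by rewrite mulr_ge0 // subr_ge0.
  lra.
- rewrite /A mxtraceD mxtraceZ [leRHS]mulrDl mul1r lerD2l.
  have trg : 0 <= \tr (gr^T *m gr) <= q * \tr H.
    have -> : \tr (gr^T *m gr) = \sum_a gr 0 a ^+ 2.
      by apply: eq_bigr => a _; rewrite mxE big_ord1 mxE expr2.
    rewrite sumr_ge0 /=; last by move=> a _; exact: sqr_ge0.
    rewrite mulr_sumr; apply: ler_sum => a _.
    (* Basis vectors give [gr_a^2 <= q H_aa], to be summed over [a]. *)
    have := CS (delta_mx 0 a).
    have -> : (gr *m (delta_mx 0 a : 'rV[R]_n)^T) 0 0 = gr 0 a.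
      by rewrite trmx_delta -colE mxE.
    by rewrite trmx_delta -rowE -colE !mxE.
  have thn : `|th| <= `|b1| + `|b2|.
    rewrite ler_norml; apply/andP; split.
      have := ler_norm (- b1); rewrite normrN; have := normr_ge0 b2; lra.
    have := ler_norm b2; have := normr_ge0 b1; lra.
  move: trg => /andP[T0 Tq].
  have -> : 2 * th / q * \tr (gr^T *m gr) = 2 * th * (\tr (gr^T *m gr) / q).
    by rewrite mulrAC mulrA.
  have : 0 <= \tr (gr^T *m gr) / q <= \tr H.
    by rewrite divr_ge0 ?(ltW q0) //= ler_pdivrMr // mulrC.
  set t := _ / q => /andP[t0 tH].
  have := ler_norm th.
  have := normr_ge0 b1; have := normr_ge0 b2.
  have : `|th| * t <= (`|b1| + `|b2|) * \tr H by rewrite ler_pM.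
  nra.
Qed.

(** * Expansion of the divergence *)

Lemma differentiable_rV {R : realType} {V : normedModType R} {n : nat}
    {F : V -> 'rV[R]_n} {y : V} :
  (forall b, differentiable (fun z => F z 0 b) y) -> differentiable F y.
Proof.
move=> dF.
have -> : F = \sum_b (fun z => F z 0 b *: delta_mx 0 b).
  by apply/funext => z; rewrite fct_sumE [LHS]row_sum_delta.
by apply: differentiable_sum => b; exact: differentiableZl.
Qed.

Lemma differentiable_bigsum {R : realType} {V : normedModType R} {n : nat}
    {F : 'I_n -> V -> R} {y : V} :
  (forall i, differentiable (F i) y) -> differentiable (fun z => \sum_i F i z) y.
Proof.
move=> dF; have -> : (fun z => \sum_i F i z) = \sum_i F i.
  by apply/funext => z; rewrite fct_sumE.
exact: differentiable_sum.
Qed.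

Lemma is_derive_bigsum {R : realType} {V : normedModType R} {n : nat}
    {F : 'I_n -> V -> R} {y v : V} {d : 'I_n -> R} :
  (forall i, is_derive y v (F i) (d i)) ->
  is_derive y v (fun z => \sum_i F i z) (\sum_i d i).
Proof.
move=> dF; have -> : (fun z => \sum_i F i z) = \sum_i F i.
  by apply/funext => z; rewrite fct_sumE.
exact: is_derive_sum.
Qed.

Section Flux.
Context {R : realType} {n : nat} {U : set 'rV[R]_n} {G : 'rV[R]_n -> 'M[R]_n}
  {u : 'rV[R]_n -> R}.
Hypothesis oU : open U.
Hypothesis C1G : forall a b, Ck 1 U (fun z => G z a b).
Hypothesis pG : forall z, U z -> posdef (G z).
Hypothesis C2u : Ck 2 U u.

Let q z := sqnorm G z (grad G u z).

Lemma C1_inverse_metric a b : Ck 1 U (fun z => invmx (G z) a b).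
Proof. by apply: C1_invmx => // z /pG; exact: posdef_unitmx. Qed.

Lemma det_posdef_gt0 z : U z -> 0 < \det (G z).
Proof.
move=> Uz; have [P E] := posdef_cholesky (pG z Uz).
have := posdef_unitmx (pG z Uz); rewrite unitmxE unitfE E det_mulmx det_tr.
by rewrite -expr2 lt0r sqr_ge0 andbT.
Qed.

Lemma vol_density_gt0 z : U z -> 0 < vol_density G z.
Proof. by move=> /det_posdef_gt0; rewrite sqrtr_gt0. Qed.

Lemma C1_vol_inverse_metric a b : Ck 1 U (fun z => vol_density G z * invmx (G z) a b).
Proof.
have Cv : Ck 1 U (fun z => vol_density G z).
  have Cd : Ck 1 U (fun z => \det (G z)) by exact: C1_det.
  exact: (C1_sqrt oU _ det_posdef_gt0 Cd).
exact: (C1M oU _ _ Cv (C1_inverse_metric a b)).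
Qed.

Lemma C1_partial a : Ck 1 U (partial a u).
Proof. by have [_ /(_ a)[]] := C2u. Qed.

Lemma gradE z b : grad G u z 0 b = \sum_c partial c u z * invmx (G z) c b.
Proof. by rewrite mxE; apply: eq_bigr => c _; rewrite mxE. Qed.

Lemma differentiable_grad z b : U z -> differentiable (fun z => grad G u z 0 b) z.
Proof.
move=> Uz; under eq_fun do rewrite gradE.
apply: differentiable_bigsum => c; apply: differentiableM.
  exact: C1_differentiable oU (C1_partial c) Uz.
exact: C1_differentiable oU (C1_inverse_metric c b) Uz.
Qed.

Lemma differentiable_sqnorm_grad z : U z -> differentiable q z.
Proof.
move=> Uz; rewrite /q /sqnorm; under eq_fun do rewrite mulmx_form.
apply: differentiable_bigsum => a; apply: differentiable_bigsum => b.
apply: differentiableM; last exact: differentiable_grad.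
apply: differentiableM; first exact: differentiable_grad.
exact: C1_differentiable oU (C1G a b) Uz.
Qed.

(** This selects the pointwise clause of [solution]. *)
Lemma differentiable_flux (Phi : R -> R) z : U z ->
  derivable (derive1 Phi) (q z) 1 -> differentiable (flux G Phi u) z.
Proof.
move=> Uz dPhi; apply: differentiable_rV => b.
rewrite /flux; under eq_fun do rewrite mxE.
apply: differentiableM; last exact: differentiable_grad.
apply: (differentiable_comp (differentiable_sqnorm_grad z Uz)).
exact/derivable1_diffP.
Qed.

(** The metric cancels against one of the two inverses, leaving [g^{cd} d_c u d_d u], which is
    simpler to differentiate. *)
Lemma sqnorm_gradE z : U z ->
  q z = \sum_c \sum_d partial c u z * invmx (G z) c d * partial d u z.
Proof.
move=> Uz; have [sI _] := posdef_invmx (pG z Uz).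
rewrite /q /sqnorm /grad trmx_mul sI !mulmxA -[_ *m invmx _ *m G z]mulmxA.
rewrite mulVmx ?mulmx1; last exact/posdef_unitmx/pG.
by rewrite mulmx_form; apply: eq_bigr => c _; apply: eq_bigr => d _; rewrite !mxE.
Qed.

Lemma partial_sqnorm_grad z a : U z ->
  is_derive z (basis_vec R a) q
   (2 * (\sum_c partial a (partial c u) z * grad G u z 0 c)
    + \sum_c \sum_d partial c u z * partial d u z * partial a (fun z => invmx (G z) c d) z).
Proof.
move=> Uz; have [sI _] := posdef_invmx (pG z Uz).
have du c : is_derive z (basis_vec R a) (partial c u) (partial a (partial c u) z).
  by apply/derivableP; have [_ /(_ a)[+ _]] := C1_partial c; apply.
have dI c d : is_derive z (basis_vec R a) (fun z => invmx (G z) c d)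
    (partial a (fun z => invmx (G z) c d) z).
  by apply/derivableP; have [_ /(_ a)[+ _]] := C1_inverse_metric c d; apply.
apply: (@near_eq_is_derive _ _ _
  (fun z => \sum_c \sum_d partial c u z * invmx (G z) c d * partial d u z)).
  have : \forall z \near z, U z by exact: open_nbhs_nbhs.
  by apply: filterS => y Uy; rewrite sqnorm_gradE.
apply: is_derive_eq (is_derive_bigsum (fun c => is_derive_bigsum (fun d =>
  is_deriveM (is_deriveM (du c) (dI c d)) (du d)))) _.
rewrite /GRing.scale /=.
(* By symmetry of the inverse metric the two terms in which a factor [du] is differentiated
   coincide; hence the factor [2]. *)
have E1 : \sum_c partial a (partial c u) z * grad G u z 0 c =
    \sum_c \sum_d partial c u z * invmx (G z) c d * partial a (partial d u) z.
  rewrite exchange_big /=; apply: eq_bigr => c _; rewrite gradE mulr_sumr.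
  by apply: eq_bigr => d _; rewrite mulrC.
have E2 : \sum_c partial a (partial c u) z * grad G u z 0 c =
    \sum_c \sum_d partial d u z * invmx (G z) c d * partial a (partial c u) z.
  apply: eq_bigr => c _; rewrite gradE mulr_sumr; apply: eq_bigr => d _.
  by rewrite -{1}sI mxE mulrC.
rewrite mulr2n mulrDl mul1r {1}E1 E2 -!big_split /=; apply: eq_bigr => c _.
rewrite -!big_split /=; apply: eq_bigr => d _; rewrite mulrfctE.
move: (partial c u z) (partial d u z) (invmx (G z) c d)
  (partial a (partial c u) z) (partial a (partial d u) z)
  (partial a (fun z => invmx (G z) c d) z) => x1 x2 x3 x4 x5 x6; ring.
Qed.

(** The density [v] is kept together with the inverse metric, so that it survives only in the first
    order coefficient [v^-1 d_a (v g^{ca})]. *)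
Lemma divergence_fluxE (Phi : R -> R) (dF : R) z : U z ->
  is_derive (q z) 1 (derive1 Phi) dF ->
  divergence G (flux G Phi u) z =
   dF * (\sum_a partial a q z * grad G u z 0 a) +
   derive1 Phi (q z) * (\sum_a \sum_c invmx (G z) c a * partial a (partial c u) z
     + (vol_density G z)^-1 * \sum_a \sum_c partial c u z *
         partial a (fun z => vol_density G z * invmx (G z) c a) z).
Proof.
move=> Uz dPhi; have v0 := vol_density_gt0 z Uz.
have E a : partial a (fun y => vol_density G y * flux G Phi u y 0 a) z =
    derive1 Phi (q z) * (\sum_c (partial c u z *
       partial a (fun z => vol_density G z * invmx (G z) c a) z
       + vol_density G z * invmx (G z) c a * partial a (partial c u) z))
    + (vol_density G z * grad G u z 0 a) * (dF * partial a q z).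
  have -> : (fun y => vol_density G y * flux G Phi u y 0 a) =
    (fun y => derive1 Phi (q y) *
      (\sum_c partial c u y * (vol_density G y * invmx (G y) c a))).
    apply/funext => y; rewrite mxE mulrCA; congr (_ * _).
    by rewrite gradE mulr_sumr; apply: eq_bigr => c _; rewrite mulrCA.
  have dq : is_derive z (basis_vec R a) (fun y => derive1 Phi (q y)) (dF * partial a q z).
    apply: is_derive_comp_real dPhi (differentiable_sqnorm_grad z Uz) _.
    exact/derivableP/diff_derivable/differentiable_sqnorm_grad.
  have dm c : is_derive z (basis_vec R a)
     (fun y => partial c u y * (vol_density G y * invmx (G y) c a))
     (partial c u z * partial a (fun z => vol_density G z * invmx (G z) c a) z
       + vol_density G z * invmx (G z) c a * partial a (partial c u) z).
    apply: is_deriveM; apply/derivableP.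
      by have [_ /(_ a)[+ _]] := C1_partial c; apply.
    by have [_ /(_ a)[+ _]] := C1_vol_inverse_metric c a; apply.
  rewrite /partial (@derive_val _ _ _ _ _ _ _ (is_deriveM dq (is_derive_bigsum dm))).
  rewrite /GRing.scale /=; congr (_ + _ * _).
  by rewrite gradE mulr_sumr; apply: eq_bigr => c _; rewrite mulrCA.
rewrite /divergence (eq_bigr _ (fun a _ => E a)) big_split /= mulrDr addrC; congr (_ + _).
  rewrite mulrC mulr_suml mulr_sumr; apply: eq_bigr => a _.
  by field; rewrite gt_eqF.
rewrite -mulr_sumr mulrCA; congr (_ * _).
rewrite !mulr_sumr -big_split /=; apply: eq_bigr => a _.
rewrite !mulr_sumr -big_split /=; apply: eq_bigr => c _.
by field; rewrite gt_eqF.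
Qed.

End Flux.

(** * The elliptic inequality for solutions *)

Lemma coord_sqr_le_sqn {R : realDomainType} {n : nat} (w : 'rV[R]_n) c : w 0 c ^+ 2 <= sqn w.
Proof.
rewrite /sqn (bigD1 c) //= lerDl.
by apply: sumr_ge0 => j _; apply: sqr_ge0.
Qed.

Lemma coord_mul_le_sqn {R : realDomainType} {n : nat} (w : 'rV[R]_n) c d :
  `|w 0 c * w 0 d| <= sqn w.
Proof.
have hc := coord_sqr_le_sqn w c; have hd := coord_sqr_le_sqn w d.
rewrite ler_norml; apply/andP; split.
  by have := sqr_ge0 (w 0 c + w 0 d); nra.
by have := sqr_ge0 (w 0 c - w 0 d); nra.
Qed.

Lemma ler_norm_sum_const {R : numDomainType} {n : nat} (F : 'I_n -> R) (B : R) :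
  (forall i, `|F i| <= B) -> `|\sum_i F i| <= n%:R * B.
Proof.
move=> FB; apply: le_trans (ler_norm_sum _ _ _) _.
have -> : n%:R * B = \sum_(i < n) B by rewrite sumr_const card_ord mulr_natl.
exact: ler_sum.
Qed.

(** The constant adds a [1] for positivity, the trace bound, the bound on [Z] and the bound [n K] on
    [Y]. For [Z], three sums give [n^3], and the derivatives of the inverse metric, the gradient and
    [sqn w <= K (n + 1) q] give [K^3 (n + 1)]; the last of these also cancels the [q] in
    [th / q]. *)
Lemma solution_elliptic_ineq {R : realType} {n : nat} {U : set 'rV[R]_n}
    {G : 'rV[R]_n -> 'M[R]_n} {u : 'rV[R]_n -> R} {Phi : R -> R} {b1 b2 K : R}
    {z : 'rV[R]_n} :
  open U -> (forall a b, Ck 1 U (fun z => G z a b)) ->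
  (forall z, U z -> posdef (G z)) -> Ck 2 U u -> U z ->
  (forall x, 0 < x -> derivable (derive1 Phi) x 1) ->
  (forall x, 0 < x -> 0 < derive1 Phi x) ->
  - (1 / 2) < b1 -> (forall x, 0 < x -> b1 <= theta Phi x <= b2) ->
  0 < K -> (forall a b, `|G z a b| <= K) -> (forall a b, `|invmx (G z) a b| <= K) ->
  (forall a c d, `|partial a (fun z => invmx (G z) c d) z| <= K) ->
  (forall a c, `|(vol_density G z)^-1 *
     partial a (fun z => vol_density G z * invmx (G z) c a) z| <= K) ->
  (exists a, partial a u z != 0) ->
  0 <= divergence G (flux G Phi u) z ->
  elliptic_ineq (Num.min 1 (1 + 2 * b1) / (K * n.+1%:R))
    (1 + (1 + 2 * (`|b1| + `|b2|)) * (n%:R * K) +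
     ((`|b1| + `|b2|) * (n%:R ^+ 3 * K ^+ 3 * n.+1%:R) + n%:R * K)) u z.
Proof.
move=> oU C1G pG C2u Uz dPhi Phi0 b1gt thb K0 GK IK dIK dmK [a0 ua0] div0.
pose w := \row_a partial a u z; pose H := invmx (G z).
have pGz := pG z Uz; have pH : posdef H by exact: posdef_invmx.
have [sH pH'] := pH.
have w0 : w != 0.
  by apply: contra ua0 => /eqP/rowP/(_ a0); rewrite !mxE => ->.
pose q := sqnorm G z (grad G u z).
have qE : q = (w *m H *m w^T) 0 0.
  rewrite /q (sqnorm_gradE pG) // mulmx_form.
  by apply: eq_bigr => c _; apply: eq_bigr => d _; rewrite !mxE.
have q0 : 0 < q by rewrite qE; exact: pH'.
pose th := theta Phi q; have thq : b1 <= th <= b2 := thb q q0.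
pose gr := grad G u z.
have grE : gr = w *m H by [].
have dq : is_derive q 1 (derive1 Phi) (derive1n 2 Phi q).
  by rewrite /= derive1E; exact/derivableP/dPhi.
move: (rank_one_perturbation pH w0 b1gt thq) => /=; rewrite -qE -grE.
set A := H + _; move=> [A1 A2 A3].
pose S := \sum_a `|partial a u z|.
have S0 : 0 <= S by apply: sumr_ge0.
pose T := `|b1| + `|b2|.
have T0 : 0 <= T by rewrite addr_ge0.
have thT : `|th| <= T.
  move: thq => /andP[t1 t2]; rewrite ler_norml /T; apply/andP; split.
    have := ler_norm (- b1); rewrite normrN; have := normr_ge0 b2; lra.
  have := ler_norm b2; have := normr_ge0 b1; lra.
have Kn0 : 0 < K * n.+1%:R by rewrite mulr_gt0.
have wq : sqn w <= K * n.+1%:R * q by rewrite qE; exact: invmx_form_ge.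
have grK a : `|gr 0 a| <= K * S.
  rewrite /gr gradE (le_trans (ler_norm_sum _ _ _)) // /S mulr_sumr.
  by apply: ler_sum => c _; rewrite normrM mulrC ler_wpM2r.
pose Z := \sum_a (\sum_c \sum_d partial c u z * partial d u z *
   partial a (fun z => invmx (G z) c d) z) * gr 0 a.
have ZK : `|Z| <= n%:R * ((n%:R * (n%:R * (K * n.+1%:R * q * K))) * (K * S)).
  apply: ler_norm_sum_const => a; rewrite normrM ler_pM //.
  apply: ler_norm_sum_const => c; apply: ler_norm_sum_const => d.
  rewrite normrM ler_pM // (le_trans _ wq) //.
  by have := coord_mul_le_sqn w c d; rewrite !mxE.
pose Y := \sum_a \sum_c partial c u z *
  ((vol_density G z)^-1 * partial a (fun z => vol_density G z * invmx (G z) c a) z).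
have YK : `|Y| <= n%:R * (K * S).
  apply: ler_norm_sum_const => a; rewrite (le_trans (ler_norm_sum _ _ _)) // /S mulr_sumr.
  by apply: ler_sum => c _; rewrite normrM mulrC ler_wpM2r.
have AE a c : A a c = invmx (G z) c a + 2 * th / q * (gr 0 a * gr 0 c).
  have -> : invmx (G z) c a = H a c by rewrite -{1}sH mxE.
  by rewrite mxE; congr (_ + _); rewrite mxE; congr (_ * _); rewrite mxE big_ord1 mxE.
pose X := \sum_a \sum_b A a b * partial a (partial b u) z.
(* Since [Phi'' / Phi' = th / q], division by [Phi'] collects the Hessian terms in [X]; [Z] stems
   from derivatives of the inverse metric and [Y] from those of its product with the density. *)
have XYZ : 0 <= X + th / q * Z + Y.
  have F0 := Phi0 q q0.
  rewrite -(pmulr_rge0 _ F0); apply: le_trans div0 _.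
  rewrite (divergence_fluxE oU C1G pG C2u Phi (derive1n 2 Phi q)) //.
  rewrite le_eqVlt; apply/orP; left; apply/eqP.
  have -> : \sum_a partial a (fun z => sqnorm G z (grad G u z)) z * grad G u z 0 a =
      2 * (\sum_a \sum_c gr 0 a * gr 0 c * partial a (partial c u) z) + Z.
    rewrite mulr_sumr -big_split /=; apply: eq_bigr => a _.
    rewrite {1}/partial (@derive_val _ _ _ _ _ _ _ (partial_sqnorm_grad oU C1G pG C2u z a Uz)).
    rewrite mulrDl -mulrA mulr_suml; congr (2 * _ + _).
    by apply: eq_bigr => c _; rewrite -/gr; ring.
  have -> : X = \sum_a \sum_c invmx (G z) c a * partial a (partial c u) z +
      2 * th / q * (\sum_a \sum_c gr 0 a * gr 0 c * partial a (partial c u) z).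
    rewrite mulr_sumr -big_split /=; apply: eq_bigr => a _.
    rewrite mulr_sumr -big_split /=; apply: eq_bigr => c _.
    by rewrite AE mulrDl !mulrA.
  have -> : Y = (vol_density G z)^-1 * \sum_a \sum_c partial c u z *
         partial a (fun z => vol_density G z * invmx (G z) c a) z.
    rewrite mulr_sumr; apply: eq_bigr => a _; rewrite mulr_sumr.
    by apply: eq_bigr => c _; rewrite mulrCA.
  rewrite -/q /th /theta /hfun; set D := derive1n 2 Phi q; field.
  by rewrite (gt_eqF (vol_density_gt0 pG z Uz)) (gt_eqF q0) (gt_eqF F0).
exists A; split => //.
- move=> v; rewrite mulrAC -mulrA.
  apply: le_trans (A2 v); rewrite ler_wpM2l //.
    by rewrite le_min ler01 /=; lra.
  by rewrite ler_pdivrMr // mulrC; exact: invmx_form_ge.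
- apply: le_trans A3 _; rewrite -/T.
  have trK : \tr H <= n%:R * K.
    by apply: le_trans (ler_norm _) _; apply: ler_norm_sum_const => a; exact: IK.
  have : (1 + 2 * T) * \tr H <= (1 + 2 * T) * (n%:R * K).
    by rewrite ler_wpM2l // addr_ge0 // mulr_ge0.
  have : 0 <= T * (n%:R ^+ 3 * K ^+ 3 * n.+1%:R) + n%:R * K.
    by rewrite addr_ge0 ?mulr_ge0 // ?exprn_ge0 // ltW.
  lra.
- rewrite -/X -/S -/T; apply: le_trans XYZ _.
  have h1 : th / q * Z <= T * (n%:R ^+ 3 * K ^+ 3 * n.+1%:R) * S.
    apply: le_trans (ler_norm _) _.
    rewrite (normrM (th / q)) (normrM th) normfV (gtr0_norm q0).
    have -> : `|th| / q * `|Z| = `|th| * (`|Z| / q) by rewrite mulrAC mulrA.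
    rewrite -mulrA ler_pM // ?divr_ge0 // ?(ltW q0) // ler_pdivrMr //.
    by apply: le_trans ZK _; rewrite le_eqVlt; apply/orP; left; apply/eqP; ring.
  have h2 : Y <= n%:R * K * S by rewrite -mulrA; exact: le_trans (ler_norm _) YK.
  have h3 : 0 <= (1 + (1 + 2 * T) * (n%:R * K)) * S.
    by rewrite mulr_ge0 // addr_ge0 // mulr_ge0 ?addr_ge0 ?mulr_ge0 // ltW.
  rewrite -addrA lerD2l; apply: le_trans (lerD h1 h2) _.
  rewrite -subr_ge0; apply: le_trans h3 _; rewrite le_eqVlt; apply/orP; left.
  by apply/eqP; ring.
Qed.

(** * Local and global conclusions *)

Lemma near_bounded_family {R : realType} {T : topologicalType} {I : finType}
    {f : I -> T -> R} {x : T} : (forall i, {for x, continuous (f i)}) ->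
  exists2 K, 0 < K & \forall z \near x, forall i, `|f i z| <= K.
Proof.
move=> cf; exists (1 + \sum_i `|f i x|).
  by rewrite ltr_pwDl // sumr_ge0.
apply: filter_forall => i.
have : \forall z \near x, `|f i z| < 1 + \sum_i `|f i x|.
  apply: (cvgr_lt `|f i x|); first exact: (continuous_comp (cf i) (@norm_continuous _ _ _)).
  rewrite (bigD1 i) //= addrCA ltrDl ltr_pwDl // sumr_ge0 //.
by apply: filterS => z /ltW.
Qed.

(** The choice [r = e^2 / 40] makes [10 r] equal to [(e / 2)^2]; the factor [10] is the margin of
    [strong_maximum_local]. *)
Lemma nbhs_sqn_ball {R : realType} {n : nat} {x : 'rV[R]_n} {P : set 'rV[R]_n} :
  nbhs x P -> exists2 r, 0 < r & forall y, sqn (y - x) <= 10 * r -> P y.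
Proof.
move=> /nbhs_ballP[e /= e0 eP]; exists (e ^+ 2 / 40).
  by rewrite divr_gt0 // exprn_gt0.
move=> y yx; apply: eP; rewrite -ball_normE /= -normrN opprB.
apply: (@le_lt_trans _ _ (e / 2)); last by lra.
apply: norm_leP => [|a]; first by lra.
have := coord_sqr_le_sqn (y - x) a; set t := (y - x) 0 a => h.
have : t ^+ 2 <= (e / 2) ^+ 2 by rewrite expr_div_n; lra.
by rewrite -[t ^+ 2]real_normK ?num_real // ler_sqr ?nnegrE //; lra.
Qed.

Lemma sqnorm_grad_gt0 {R : realType} {n : nat} {U : set 'rV[R]_n}
    {G : 'rV[R]_n -> 'M[R]_n} {u : 'rV[R]_n -> R} {z : 'rV[R]_n} :
  (forall z, U z -> posdef (G z)) -> U z -> (exists a, partial a u z != 0) ->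
  0 < sqnorm G z (grad G u z).
Proof.
move=> pG Uz [a ua]; have [_] := pG z Uz; apply.
apply: contra ua => /eqP/(congr1 (mulmx^~ (G z))).
rewrite mul0mx /grad -mulmxA mulVmx ?mulmx1; last exact/posdef_unitmx/pG.
by move/rowP/(_ a); rewrite !mxE => ->.
Qed.

(** All coefficients are continuous at [x0], so one [K] bounds these finitely many functions nearby
    and fixes [lam] and [L] on a small ball. *)
Lemma subsolution_locally_max {R : realType} {n : nat} {U : set 'rV[R]_n}
    {G : 'rV[R]_n -> 'M[R]_n} {u : 'rV[R]_n -> R} {Phi : R -> R} {b1 b2 m : R}
    {x0 : 'rV[R]_n} :
  open U -> (forall a b, Ck 1 U (fun z => G z a b)) ->
  (forall z, U z -> posdef (G z)) -> Ck 2 U u -> U x0 ->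
  (forall x, 0 < x -> derivable (derive1 Phi) x 1) ->
  (forall x, 0 < x -> 0 < derive1 Phi x) ->
  - (1 / 2) < b1 -> (forall x, 0 < x -> b1 <= theta Phi x <= b2) ->
  (forall z, U z -> (exists a, partial a u z != 0) ->
     0 <= divergence G (flux G Phi u) z) ->
  (forall z, U z -> u z <= m) -> u x0 = m ->
  exists2 r, 0 < r & forall z, sqn (z - x0) < r -> u z = m.
Proof.
move=> oU C1G pG C2u Ux0 dPhi Phi0 b1gt thb subsol um ux0.
have C1cont f : Ck 1 U f -> {for x0, continuous f} by case=> + _; apply.
have C1dcont a f : Ck 1 U f -> {for x0, continuous (partial a f)}.
  by case=> _ /(_ a)[_ [+ _]]; apply.
have [K1 K10 K1H] := @near_bounded_family R _ ('I_n * 'I_n)%type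
  (fun i z => G z i.1 i.2) x0 (fun i => C1cont _ (C1G i.1 i.2)).
have CI := C1_inverse_metric oU C1G pG.
have Cm := C1_vol_inverse_metric oU C1G pG.
have [K2 K20 K2H] := @near_bounded_family R _ ('I_n * 'I_n)%type
  (fun i z => invmx (G z) i.1 i.2) x0 (fun i => C1cont _ (CI i.1 i.2)).
have [K3 K30 K3H] := @near_bounded_family R _ ('I_n * ('I_n * 'I_n))%type
  (fun i => partial i.1 (fun z => invmx (G z) i.2.1 i.2.2)) x0
  (fun i => C1dcont i.1 _ (CI i.2.1 i.2.2)).
have cvol : {for x0, continuous (fun z => (vol_density G z)^-1)}.
  apply: continuousV; first by rewrite gt_eqF // (vol_density_gt0 pG).
  have Cd : Ck 1 U (fun z => \det (G z)) by exact: C1_det.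
  exact: C1cont _ (C1_sqrt oU _ (det_posdef_gt0 pG) Cd).
have [K4 K40 K4H] := @near_bounded_family R _ ('I_n * 'I_n)%type
  (fun i z => (vol_density G z)^-1 *
     partial i.1 (fun z => vol_density G z * invmx (G z) i.2 i.1) z) x0
  (fun i => continuousM cvol (C1dcont i.1 _ (Cm i.2 i.1))).
pose K := K1 + K2 + K3 + K4.
have K0 : 0 < K by rewrite !addr_gt0.
have [K1K K2K K3K K4K] : [/\ K1 <= K, K2 <= K, K3 <= K & K4 <= K].
  by rewrite /K; split; lra.
have nU : nbhs x0 U by exact: open_nbhs_nbhs.
have [r r0 rH] := nbhs_sqn_ball (filterI nU (filterI K1H (filterI K2H (filterI K3H K4H)))).
exists r => //.
set lam := Num.min 1 (1 + 2 * b1) / (K * n.+1%:R).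
have lam0 : 0 < lam.
  rewrite divr_gt0 ?mulr_gt0 // lt_min ltr01 /=; lra.
have T0 : 0 <= `|b1| + `|b2| by rewrite addr_ge0.
apply: (strong_maximum_local oU C2u lam0 _ _ um _ ux0
  (L := 1 + (1 + 2 * (`|b1| + `|b2|)) * (n%:R * K) +
     ((`|b1| + `|b2|) * (n%:R ^+ 3 * K ^+ 3 * n.+1%:R) + n%:R * K))).
- rewrite -addrA ltr_pwDl // !addr_ge0 ?mulr_ge0 ?exprn_ge0 ?addr_ge0 ?mulr_ge0 //; exact: ltW.
- by move=> y /rH[].
move=> y /rH[Uy [H1 [H2 [H3 H4]]]] dy.
apply: (solution_elliptic_ineq oU C1G pG C2u Uy dPhi Phi0 b1gt thb K0 _ _ _ _ dy).
- by move=> a b; apply: le_trans K1K; exact: (H1 (a, b)).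
- by move=> a b; apply: le_trans K2K; exact: (H2 (a, b)).
- by move=> a c d; apply: le_trans K3K; exact: (H3 (a, (c, d))).
- by move=> a c; apply: le_trans K4K; exact: (H4 (a, c)).
exact: subsol.
Qed.

(** * From charts to the manifold *)

Lemma smooth_fun_continuous {R : realType} {n : nat} {M : topologicalType}
    {A : smooth_manifold R n M} {u : M -> R} :
  smooth_fun A u -> continuous u.
Proof.
move=> su x; have [i ix] := dom_cover A x.
have : {for x, continuous (fun y => (u \o param i) (Defs.coord i y))}.
  have cui : {for Defs.coord i x, continuous (u \o param i)}.
    by have [+ _] := su i 0%N; apply; exists x.
  exact: (continuous_comp (Defs.coord_continuous ix) cui).
apply: for_continuous_near_eq.
have : \forall y \near x, dom i y by apply: open_nbhs_nbhs; split=> //; exact: dom_open.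
by apply: filterS => y iy; rewrite /= coordK.
Qed.

Lemma metric_posdef {R : realType} {n : nat} {M : topologicalType}
    {A : smooth_manifold R n M} (g : riemannian_metric A) (i : chart A) y :
  img i y -> posdef (gmx g i y).
Proof.
by move=> iy; split=> [|v]; [exact: gmx_sym|exact: gmx_posdef].
Qed.

(** A nonzero differential gives [|grad u|^2 > 0], where [Phi'] is derivable; the flux is then
    differentiable, and the equation equates its divergence with [(p / 2) Phi >= 0]. *)
Lemma solution_divergence_ge0 {R : realType} {n : nat} {M : topologicalType}
    {A : smooth_manifold R n M} {g : riemannian_metric A} {p : R} {Phi : R -> R}
    {u : M -> R} (i : chart A) z :
  0 <= p -> admissible Phi -> smooth_fun A u -> solution g Phi p u -> img i z ->
  (exists a, partial a (u \o param i) z != 0) ->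
  0 <= divergence (gmx g i) (flux (gmx g i) Phi (u \o param i)) z.
Proof.
move=> p0 [_ Phi0 dPhi _ _] su sol iz dz.
have q0 := sqnorm_grad_gt0 (metric_posdef g i) iz dz.
have [cl _] := sol i z iz.
have : classical_eq_at (gmx g i) Phi p (u \o param i) z.
  apply: cl; exact: (@differentiable_flux R n (img i) _ _ (@img_open R n M A i)
    (fun a b => gmx_smooth g i a b 1%N) (metric_posdef g i) (su i 2%N) Phi z iz
    (dPhi 1%N isT _ q0)).
move/eqP; rewrite subr_eq0 => /eqP ->.
by rewrite mulr_ge0 ?divr_ge0 // Phi0 // ltW.
Qed.

Theorem theorem1p9 (R : realType) (n : nat) (M : topologicalType)
  (A : smooth_manifold R n M) (g : riemannian_metric A)
  (M_compact : compact [set: M])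
  (Ric_ge0 : ricci_nonneg g)
  (p : R) (p_gt1 : 1 < p)
  (Phi : R -> R) (Phi_adm : admissible Phi)
  (Phi_S : structure_assumption n Phi)
  (b1 b2 : R) (b1_gt : - (1 / 2) < b1)
  (theta_bound : forall x : R, 0 < x -> b1 <= theta Phi x <= b2)
  (u : M -> R) (u_smooth : smooth_fun A u) (u_pos : forall x, 0 < u x)
  (u_sol : solution g Phi p u)
  (u_bound : exists c C : R, [/\ 0 < c, 0 < C & forall x, c < u x < C]) :
  exists k : R, forall x : M, u x = k.
Proof.
(* [connected] allows the empty space, on which any constant will do. *)
have [[x1 _]|M0] := pselect (exists x : M, True); last first.
  by exists 0 => x; exfalso; apply: M0; exists x.
have cu := smooth_fun_continuous u_smooth.
have [x0 _ x0max] := compact_EVT_max (ex_intro _ x1 I) M_compact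
  (continuous_subspaceT cu).
exists (u x0).
suff E : [set x | u x = u x0] = [set: M].
  by move=> x; have : [set: M] x by []; rewrite -E.
apply: (mfd_connected A); first by exists x0.
- exists [set x | u x = u x0]; last by rewrite setTI.
  rewrite openE => x /= ux; rewrite /interior.
  have [i ix] := dom_cover A x.
  have [_ _ dPhi _ Phi'0] := Phi_adm.
  have ix' : img i (Defs.coord i x) by exists x.
  have [r r0 rH] := subsolution_locally_max (m := u x0) (@img_open R n M A i : open (img i))
    (fun a b => gmx_smooth g i a b 1%N) (metric_posdef g i) (u_smooth i 2%N) ix'
    (dPhi 1%N isT) Phi'0 b1_gt theta_bound
    (fun z => solution_divergence_ge0 i z (ltW (lt_trans ltr01 p_gt1)) Phi_adm
       u_smooth u_sol) (fun z _ => x0max _ (in_setT _)) (etrans (congr1 u (coordK ix)) ux).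
  have dx : \forall y \near x, dom i y.
    by apply: open_nbhs_nbhs; split=> //; exact: dom_open.
  have bx : \forall y \near x, sqn (Defs.coord i y - Defs.coord i x) < r.
    have c : {for x, continuous (fun y => sqn (Defs.coord i y - Defs.coord i x))}.
      exact: (continuous_comp (Defs.coord_continuous ix) (continuous_sqnB (Defs.coord i x) _)).
    apply: (cvgr_lt _ c).
    by rewrite subrr /sqn big1 // => a _; rewrite mxE expr0n.
  (* The chart is continuous and [param] inverts it on its domain, so the coordinate ball pulls back
     to a neighbourhood of [x]. *)
  by apply: filterS2 dx bx => y iy /rH; rewrite /= coordK.
- exists [set x | u x = u x0]; last by rewrite setTI.
  by apply: (preimage_closed (D := [set t : R | t = u x0]));
    [move=> x _; exact: cu|exact: closed_eq].
Qed.
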